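(* For every prime $p\geq 5$ with $p\equiv 3\pmod{4}$, $$ \sum_{k=0}^{(p-1)/2}\frac{(\tfrac{5}{4})_k\,(\tfrac12)_k^5}{(\tfrac14)_k\,(1)_k^4}\cdot\frac{(-1)^k}{k!}\equiv-\frac{p^3}{16}\,\Gamma_p\!\left(\tfrac14\right)^4\pmod{p^5}. $$ Equivalently, $$ {}_6F_5\bigg[\begin{matrix}\tfrac{5}{4}&\tfrac{1}{2}&\tfrac{1}{2}&\tfrac{1}{2}&\tfrac{1}{2}&\tfrac{1}{2}\\&\tfrac{1}{4}&1&1&1&1\end{matrix}\bigg|\ -1\bigg]_{\frac{p-1}{2}}\equiv-\frac{p^3}{16}\,\Gamma_p\!\left(\tfrac14\right)^4\pmod{p^5}. $$
   Context: For $x\in\mathbb{C}$ and integer $k\geq0$, the Pochhammer symbol is $(x)_k=x(x+1)\cdots(x+k-1)$ for $k\geq1$ and $(x)_0=1$. The truncated hypergeometric series is $$ {}_nF_{n-1}\bigg[\begin{matrix}x_1&\cdots&x_n\\&y_1&\cdots&y_{n-1}\end{matrix}\bigg|\ z\bigg]_m=\sum_{k=0}^{m}\frac{(x_1)_k\cdots(x_n)_k}{(y_1)_k\cdots(y_{n-1})_k}\cdot\frac{z^k}{k!}. $$ The congruence is in $\mathbb{Z}_p$ (the left side is a rational number with $p$-adically integral terms). $\Gamma_p$ is Morita's $p$-adic Gamma function: for integers $n\geq1$, $\Gamma_p(n)=(-1)^n\prod_{1\leq k<n,\ p\nmid k}k$, $\Gamma_p(0)=1$, and for $x\in\mathbb{Z}_p$,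 $\Gamma_p(x)=\lim_{n\to x}\Gamma_p(n)$, the limit taken over positive integers $n$ converging $p$-adically to $x$. *)

(* Defs.v *)
From HB Require Import structures.
From mathcomp Require Import all_boot all_order all_algebra.
From mathcomp Require Import boolp classical_sets filter topology_structure.
Set Implicit Arguments.
Unset Strict Implicit.
Unset Printing Implicit Defensive.
Import GRing.Theory.
Local Open Scope ring_scope.
Local Open Scope classical_set_scope.

Definition pochhammer (F : fieldType) (x : F) (k : nat) : F :=
  \prod_(i < k) (x + i%:R).

(* The last argument is the last summation index, so there are m.+1 terms. *)
Definition hypergeom_trunc (F : fieldType) (xs ys : seq F) (z : F) (m : nat)
    : F :=
  \sum_(0 <= k < m.+1)
    (\prod_(x <- xs) pochhammer x k) / (\prod_(y <- ys) pochhammer y k)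
      * (z ^+ k / (k`!)%:R).

(* Z_p as the inverse limit of the Z/p^n: [residue x n] is the representative
   of [x] modulo p^n in the interval [0, p^n). *)
Record padic_int (p : nat) (p_pr : prime p) := PadicInt {
  residue :> nat -> nat;
  residueP : forall n, residue n = (residue n.+1 %% p ^ n)%N }.

Section PadicInt.
Variables (p : nat) (p_pr : prime p).
Local Notation Zp := (padic_int p_pr).

HB.instance Definition _ := gen_eqMixin Zp.
HB.instance Definition _ := gen_choiceMixin Zp.

Lemma padic_ext (x y : Zp) : (forall n, x n = y n) -> x = y.
Proof.
case: x y => [x xP] [y yP] /= /funext xy.
rewrite xy in xP *; congr PadicInt; exact: Prop_irrelevance.
Qed.

Lemma residue_mod (x : Zp) n : (x n %% p ^ n)%N = x n.
Proof. by rewrite residueP modn_mod. Qed.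

Lemma residue_mod_le (x : Zp) m n : (m <= n)%N -> (x n %% p ^ m)%N = x m.
Proof.
elim: n => [|n IH]; first by rewrite leqn0 => /eqP ->; exact: residue_mod.
rewrite leq_eqVlt => /predU1P[-> | mn]; first exact: residue_mod.
by rewrite -IH // [x n]residueP modn_dvdm // dvdn_exp2l.
Qed.

Fact padic_mk_subproof (f : nat -> nat) :
    (forall n, f n.+1 = f n %[mod p ^ n]) ->
  forall n, (f n %% p ^ n = (f n.+1 %% p ^ n.+1) %% p ^ n)%N.
Proof. by move=> fP n; rewrite modn_dvdm ?dvdn_exp2l // fP. Qed.

Definition padic_mk f fP : Zp := PadicInt p_pr (@padic_mk_subproof f fP).

Fact padic_add_subproof (x y : Zp) n :
  (x n.+1 + y n.+1 = x n + y n %[mod p ^ n])%N.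
Proof. by rewrite -modnDm -!residueP. Qed.

Fact padic_mul_subproof (x y : Zp) n :
  (x n.+1 * y n.+1 = x n * y n %[mod p ^ n])%N.
Proof. by rewrite -modnMm -!residueP. Qed.

Lemma residue_le (x : Zp) n : (x n <= p ^ n)%N.
Proof. by rewrite -(residue_mod x) ltnW // ltn_mod expn_gt0 prime_gt0. Qed.

Fact padic_opp_subproof (x : Zp) n :
  (p ^ n.+1 - x n.+1 = p ^ n - x n %[mod p ^ n])%N.
Proof.
apply/eqP; rewrite -(eqn_modDr (x n.+1)) subnK ?residue_le //.
rewrite -[X in _ == X]modnDmr -residueP subnK ?residue_le //.
by rewrite modnn expnS modnMl.
Qed.

Definition padic_add (x y : Zp) := padic_mk (padic_add_subproof x y).
Definition padic_mul (x y : Zp) := padic_mk (padic_mul_subproof x y).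
Definition padic_opp (x : Zp) := padic_mk (padic_opp_subproof x).
Definition padic_nat (k : nat) : Zp :=
  @padic_mk (fun=> k) (fun=> erefl).

Fact padic_addA : associative padic_add.
Proof.
by move=> x y z; apply: padic_ext => n /=; rewrite modnDml modnDmr addnA.
Qed.

Fact padic_addC : commutative padic_add.
Proof. by move=> x y; apply: padic_ext => n /=; rewrite addnC. Qed.

Fact padic_add0 : left_id (padic_nat 0) padic_add.
Proof.
by move=> x; apply: padic_ext => n /=; rewrite mod0n add0n residue_mod.
Qed.

Fact padic_addN : left_inverse (padic_nat 0) padic_opp padic_add.
Proof.
move=> x; apply: padic_ext => n /=.
by rewrite modnDml subnK ?residue_le // modnn mod0n.
Qed.

HB.instance Definition _ :=
  GRing.isZmodule.Build Zp padic_addA padic_addC padic_add0 padic_addN.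

Fact padic_mulA : associative padic_mul.
Proof.
by move=> x y z; apply: padic_ext => n /=; rewrite modnMml modnMmr mulnA.
Qed.

Fact padic_mulC : commutative padic_mul.
Proof. by move=> x y; apply: padic_ext => n /=; rewrite mulnC. Qed.

Fact padic_mul1 : left_id (padic_nat 1) padic_mul.
Proof.
by move=> x; apply: padic_ext => n /=; rewrite modnMml mul1n residue_mod.
Qed.

Fact padic_mulD : left_distributive padic_mul padic_add.
Proof.
move=> x y z; apply: padic_ext => n /=.
by rewrite modnMml modnDml modnDmr mulnDl.
Qed.

Fact padic_one_neq0 : padic_nat 1 != 0.
Proof.
apply/eqP => /(congr1 (fun x : Zp => x 1%N)) /=.
by rewrite expn1 mod0n modn_small // prime_gt1.
Qed.

HB.instance Definition _ :=
  GRing.Zmodule_isComNzRing.Build Zp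
    padic_mulA padic_mulC padic_mul1 padic_mulD padic_one_neq0.

Definition padic_unit : pred Zp := fun x => `[< exists y : Zp, y * x = 1 >].
Definition padic_inv (x : Zp) : Zp := xget x [set y | y * x = 1].

Fact padic_mulVx : {in padic_unit, left_inverse 1 padic_inv *%R}.
Proof.
move=> x /asboolP x_unit; rewrite /padic_inv.
by case: xgetP => [y _ // | noinv]; case: x_unit => y /noinv.
Qed.

Fact padic_unitPl (x y : Zp) : y * x = 1 -> padic_unit x.
Proof. by move=> yx1; apply/asboolP; exists y. Qed.

Fact padic_inv_out : {in [predC padic_unit], padic_inv =1 id}.
Proof.
move=> x /asboolP x_nunit; rewrite /padic_inv.
by case: xgetP => // y _ yx1; case: x_nunit; exists y.
Qed.

HB.instance Definition _ :=
  GRing.ComNzRing_hasMulInverse.Build Zp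
    padic_mulVx padic_unitPl padic_inv_out.

Lemma padic_neq0P (x : Zp) : x != 0 -> exists n, x n != 0%N.
Proof.
move=> x0; apply: contrapT => nex; case/eqP: x0; apply: padic_ext => n /=.
by rewrite mod0n; apply: contrapT => /eqP xn; apply: nex; exists n.
Qed.

Fact padic_mulf_eq0 (x y : Zp) : x * y = 0 -> (x == 0) || (y == 0).
Proof.
move=> xy0; apply/norP => -[/padic_neq0P[a xa] /padic_neq0P[b yb]].
have nz (z : Zp) c n : z c != 0%N -> (c <= n)%N ->
    ((0 < z n) && (logn p (z n) < c))%N.
  move=> zc cn; have zn : (0 < z n)%N.
    rewrite lt0n; apply: contra_neq zc => zn.
    by rewrite -(residue_mod_le z cn) zn mod0n.
  rewrite zn ltnNge; apply: contra zc => le_c.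
  by rewrite -(residue_mod_le z cn) -/(dvdn _ _) pfactor_dvdn.
have /andP[xn lx] := nz x a (a + b)%N xa (leq_addr _ _).
have /andP[yn ly] := nz y b (a + b)%N yb (leq_addl _ _).
have := congr1 (fun z : Zp => z (a + b)%N) xy0; rewrite /= mod0n => /eqP.
rewrite -/(dvdn _ _) pfactor_dvdn ?muln_gt0 ?xn // lognM // leqNgt.
by rewrite -addnS leq_add // ltnW.
Qed.

HB.instance Definition _ :=
  GRing.ComUnitRing_isIntegral.Build Zp padic_mulf_eq0.

(* The p-adic topology: the basic neighbourhoods of [x] are the x + p^n Z_p. *)
Definition padic_nbhs (x : Zp) : set_system Zp :=
  [set A | exists n, forall y : Zp, y n = x n -> A y].

HB.instance Definition _ := hasNbhs.Build Zp padic_nbhs.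

Fact padic_nbhs_filter (x : Zp) : ProperFilter (nbhs x).
Proof.
split; first by case=> n /(_ x erefl).
split; first by exists 0%N.
- move=> A B [m Am] [n Bn]; exists (maxn m n) => y yx; split.
    by apply: Am; rewrite -!(residue_mod_le _ (leq_maxl m n)) yx.
  by apply: Bn; rewrite -!(residue_mod_le _ (leq_maxr m n)) yx.
- by move=> A B AB [n An]; exists n => y /An /AB.
Qed.

Fact padic_nbhs_singleton (x : Zp) (A : set Zp) : nbhs x A -> A x.
Proof. by case=> n; apply. Qed.

Fact padic_nbhs_nbhs (x : Zp) (A : set Zp) : nbhs x A -> nbhs x (nbhs^~ A).
Proof.
by case=> n An; exists n => y yx; exists n => z zy; apply: An; rewrite zy.
Qed.

HB.instance Definition _ :=
  Nbhs_isNbhsTopological.Build Zp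
    padic_nbhs_filter padic_nbhs_singleton padic_nbhs_nbhs.

HB.instance Definition _ := isPointed.Build Zp 0.

Definition gammap_nat (n : nat) : Zp :=
  (-1) ^+ n * \prod_(1 <= k < n | ~~ (p %| k)%N) k%:R.

(* The filter "n --> x p-adically, with n a positive integer". *)
Definition posnat_to (x : Zp) : set_system nat :=
  filter_from (nbhs x) (fun U => [set n : nat | (0 < n)%N /\ U n%:R]).

Definition gammap (x : Zp) : Zp := lim (gammap_nat n @[n --> posnat_to x]).

End PadicInt.

Notation padic p_pr := {fraction (padic_int p_pr)}.

Definition padic_eqmod (p : nat) (p_pr : prime p) (m : nat)
    (x y : padic p_pr) : Prop :=
  exists c : padic_int p_pr, x - y = tofrac (m%:R * c).

(* Main.v *)
(* Write p = 4m + 3 and n = (p - 1)/2 = 2m + 1.  Deform the k-th term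
   (-1)^k (4k+1) ((1/2)_k / k!)^5 into
     (-1)^k (4k+1) (1/2)_k/k! * prod_(i<k) ((2i+1)^2-x)/((2i+2)^2-x)
                              * prod_(i<k) ((2i+1)^2-y)/((2i+2)^2-y).
   For x = p^2 the sum over k <= n terminates naturally and equals
     p y prod_(j=1..m) ((4j)^2-y) / prod_(j=0..m) ((4j+2)^2-y).
   At x = p^2 and y = -p^2 the two products combine into a function of p^4 only,
   so the sum differs from the original one by p^4 times a p-integral number;
   that number is 0 modulo p because its terms are antisymmetric under
   k -> n - k.  Hence the sum is
   -p^3 prod_(j=1..m) (4j)^2 / prod_(j=0..m) (4j+2)^2 modulo p^5.
   The remaining quotient is needed only modulo p^2, where Gamma_p(1/4) is
   Gamma_p((3p^2+1)/4), a product of integers in which each block of p - 1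
   factors between consecutive multiples of p is (p-1)! modulo p^2. *)
Require Import Defs.
From HB Require Import structures.
From mathcomp Require Import all_boot all_order all_algebra.
From mathcomp Require Import cyclic.
From mathcomp Require Import classical_sets filter topology_structure.
From mathcomp Require Import ring lra zify.
Set Implicit Arguments.
Unset Strict Implicit.
Unset Printing Implicit Defensive.
Import Order.TTheory GRing.Theory Num.Theory.
Local Open Scope ring_scope.


(** * A terminating well-poised sum *)

Section WellPoisedSum.
Variable F : numFieldType.
Implicit Types (x y : F) (n k : nat).

Definition odd_even_ratio k : F := \prod_(i < k) ((2 * i + 1)%:R / (2 * i + 2)%:R).

(** For [x = z^2] this is [((1-z)/2)_k ((1+z)/2)_k / ((1-z/2)_k (1+z/2)_k)]. Using [x] instead of
    [z] as parameter allows [x = -p^2] over the rationals. *)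
Definition shifted_ratio x k : F :=
  \prod_(i < k) (((2 * i + 1)%:R ^+ 2 - x) / ((2 * i + 2)%:R ^+ 2 - x)).

Definition well_poised_term n y k : F :=
  (-1) ^+ k * (4 * k + 1)%:R * odd_even_ratio k * shifted_ratio y k
  * shifted_ratio ((2 * n + 1)%:R ^+ 2) k.

Lemma odd_even_ratioS k :
  odd_even_ratio k.+1 = odd_even_ratio k * ((2 * k + 1)%:R / (2 * k + 2)%:R).
Proof. by rewrite /odd_even_ratio big_ord_recr. Qed.

Lemma shifted_ratioS x k : shifted_ratio x k.+1 =
  shifted_ratio x k * (((2 * k + 1)%:R ^+ 2 - x) / ((2 * k + 2)%:R ^+ 2 - x)).
Proof. by rewrite /shifted_ratio big_ord_recr. Qed.

Lemma shifted_ratio_eq0 n k : (n < k)%N ->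
  shifted_ratio ((2 * n + 1)%:R ^+ 2) k = 0.
Proof.
move=> lt_nk; apply/eqP; rewrite prodf_seq_eq0; apply/hasP.
by exists (Ordinal lt_nk); rewrite ?mem_index_enum //= subrr mul0r.
Qed.

Local Ltac nonzero_int z :=
  match goal with |- is_true (?e != 0) =>
    rewrite (_ : e = z%:~R); [by rewrite intr_eq0; lia | by ring]
  end.

(** At [x = (2n+1)^2] the ratio is [(-n)_k (n+1)_k / ((1/2-n)_k (n+3/2)_k)]. Moving [n] by 2 alters
    each Pochhammer symbol only at its ends, so the quotient is rational in [n] and [k]. *)
Lemma shifted_ratio_add2 n k :
  let N : F := n%:R in let K : F := k%:R in
  shifted_ratio ((2 * n + 1)%:R ^+ 2) k =
  shifted_ratio ((2 * (n + 2) + 1)%:R ^+ 2) k *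
    ((2 * N + 1) * (K - N - 1) * (K - N - 2) * (2 * N + 2 * K + 3)
       * (2 * N + 2 * K + 5))
    / ((K + N + 1) * (K + N + 2) * (2 * K - 2 * N - 1) * (2 * K - 2 * N - 3)
       * (2 * N + 5)).
Proof.
move=> N K; rewrite /K {K}.
(* No denominator vanishes: sums are positive, and differences are odd integers. *)
have n1 j : j%:R + N + 1 != 0 by nonzero_int (j%:Z + n%:Z + 1).
have n2 j : j%:R + N + 2 != 0 by nonzero_int (j%:Z + n%:Z + 2).
have n3 j : 2 * j%:R - 2 * N - 1 != 0 by nonzero_int (2 * j%:Z - 2 * n%:Z - 1).
have n4 j : 2 * j%:R - 2 * N - 3 != 0 by nonzero_int (2 * j%:Z - 2 * n%:Z - 3).
have n5 : 2 * N + 5 != 0 by nonzero_int (2 * n%:Z + 5).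
have n6 j : 2 * j%:R + 2 * N + 3 != 0 by nonzero_int (2 * j%:Z + 2 * n%:Z + 3).
have n7 j : 2 * j%:R + 2 * N + 7 != 0 by nonzero_int (2 * j%:Z + 2 * n%:Z + 7).
have n8 j : 2 * j%:R - 2 * N + 1 != 0 by nonzero_int (2 * j%:Z - 2 * n%:Z + 1).
elim: k => [|k IH].
  have := n1 0; have := n2 0; have := n3 0; have := n4 0.
  rewrite mulr0n mulr0 sub0r !add0r /shifted_ratio !big_ord0 => h4 h3 h2 h1.
  by field; rewrite n5 h4 h3 h2 h1.
rewrite !shifted_ratioS IH.
have -> : (2 * k + 2)%:R ^+ 2 - (2 * n + 1)%:R ^+ 2 =
   (2 * k%:R - 2 * N + 1) * (2 * k%:R + 2 * N + 3) :> F by ring.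
have -> : (2 * k + 2)%:R ^+ 2 - (2 * (n + 2) + 1)%:R ^+ 2 =
   (2 * k%:R - 2 * N - 3) * (2 * k%:R + 2 * N + 7) :> F by ring.
have e (z : F) : (k.+1%:R = k%:R + 1 :> F) by ring.
have := n1 k.+1; have := n2 k.+1; have := n3 k.+1; have := n4 k.+1.
rewrite e // => h4 h3 h2 h1.
by field; rewrite ?(n1, n2, n3, n4, n5, n6, n7, n8, h1, h2, h3, h4).
Qed.

(* The certificate of the creative telescoping in [n], with step 2: the sum
   itself satisfies a first-order recurrence from [n] to [n + 2]. *)
Definition wz_cert n y k : F :=
  let N : F := n%:R in let K : F := k%:R in
  - 2 * (2 * N + 3) * (2 * N + 1) * (-1) ^+ k * odd_even_ratio k
  * shifted_ratio y k * shifted_ratio ((2 * (n + 2) + 1)%:R ^+ 2) k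
  * (K * (4 * K ^+ 2 - y) * (2 * N + 2 * K + 5))
  / ((K + N + 1) * (K + N + 2) * (2 * K - 2 * N - 3)).

Variables (y : F) (y_even : forall i : nat, (2 * i + 2)%:R ^+ 2 - y != 0).

(** Once the products common to all terms are pulled out, the induction step is an identity of
    rational functions in [n], [k] and [y]. *)
Lemma wz_telescope n k :
  \sum_(i < k) ((2 * n + 1)%:R * ((2 * n + 4)%:R ^+ 2 - y) * well_poised_term (n + 2) y i
    - (2 * n + 5)%:R * ((2 * n + 2)%:R ^+ 2 - y) * well_poised_term n y i)
  = wz_cert n y k.
Proof.
set N : F := n%:R.
have n1 j : j%:R + N + 1 != 0 by nonzero_int (j%:Z + n%:Z + 1).
have n2 j : j%:R + N + 2 != 0 by nonzero_int (j%:Z + n%:Z + 2).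
have n3 j : 2 * j%:R - 2 * N - 1 != 0 by nonzero_int (2 * j%:Z - 2 * n%:Z - 1).
have n4 j : 2 * j%:R - 2 * N - 3 != 0 by nonzero_int (2 * j%:Z - 2 * n%:Z - 3).
have n5 : 2 * N + 5 != 0 by nonzero_int (2 * n%:Z + 5).
have n7 j : 2 * j%:R + 2 * N + 7 != 0 by nonzero_int (2 * j%:Z + 2 * n%:Z + 7).
elim: k => [|k IH].
  (* The certificate carries the factor [K], which is zero here. *)
  by rewrite big_ord0 /wz_cert mulr0n !(mul0r, mulr0).
have n9 : (2 * k%:R + 2) ^+ 2 - y != 0.
  by have := y_even k; rewrite natrD natrM.
have n10 : 2 * k%:R + 2 != 0 :> F by nonzero_int (2 * k%:Z + 2).
rewrite big_ord_recr /= IH /well_poised_term /wz_cert (shifted_ratio_add2 n).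
rewrite !shifted_ratioS odd_even_ratioS.
have -> : (2 * k + 2)%:R ^+ 2 - (2 * (n + 2) + 1)%:R ^+ 2 =
   (2 * k%:R - 2 * N - 3) * (2 * k%:R + 2 * N + 7) :> F by ring.
have e : (k.+1%:R = k%:R + 1 :> F) by ring.
have := n1 k.+1; have := n2 k.+1; have := n4 k.+1.
rewrite e [(-1) ^+ k.+1]exprS => h4 h2 h1.
set s := (-1) ^+ k; set u := odd_even_ratio k; set v := shifted_ratio y k.
set w := shifted_ratio _ k.
by field; rewrite ?(n1, n2, n3, n4, n5, n7, n9, n10, h1, h2, h4).
Qed.

Definition well_poised_sum n y : F := \sum_(k < n.+1) well_poised_term n y k.

(** At [k = n + 3] the certificate contains a vanishing [shifted_ratio], so the telescoped sum is
    zero. Its range exceeds that of the sum for [n] by two terms, both zero. *)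
Lemma well_poised_sum_rec n :
  (2 * n + 1)%:R * ((2 * n + 4)%:R ^+ 2 - y) * well_poised_sum (n + 2) y =
  (2 * n + 5)%:R * ((2 * n + 2)%:R ^+ 2 - y) * well_poised_sum n y.
Proof.
have := wz_telescope n n.+3.
rewrite {1}/wz_cert shifted_ratio_eq0; last by lia.
rewrite mulr0 !mul0r sumrB -!mulr_sumr => /subr0_eq.
rewrite /well_poised_sum addn2 => ->; congr (_ * _).
rewrite 2!big_ord_recr /= /well_poised_term (@shifted_ratio_eq0 n n.+1) //.
by rewrite (@shifted_ratio_eq0 n n.+2) // !mulr0 !addr0.
Qed.

(* Classically this is Whipple's transformation of a 6F5(-1) into a 3F2(1)
   followed by Whipple's 3F2 summation. *)
Lemma well_poised_sum_odd m :
  well_poised_sum (2 * m + 1) y =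
  (4 * m + 3)%:R * y * (\prod_(j < m) ((4 * j + 4)%:R ^+ 2 - y))
  / \prod_(j < m.+1) ((4 * j + 2)%:R ^+ 2 - y).
Proof.
have y_even2 j : (4 * j + 2)%:R ^+ 2 - y != 0.
  by have := y_even (2 * j); rewrite mulnA.
elim: m => [|m IH].
  have y2 : 4 - y != 0 by have := y_even 0; rewrite -natrX.
  rewrite /well_poised_sum /well_poised_term /odd_even_ratio /shifted_ratio.
  rewrite !big_ord_recl !big_ord0 /= /bump /=; field.
  by [].
have := well_poised_sum_rec (2 * m + 1).
have -> : (2 * m + 1 + 2 = 2 * m.+1 + 1)%N by lia.
have -> : (2 * (2 * m + 1) + 4 = 4 * m.+1 + 2)%N by lia.
have -> : (2 * (2 * m + 1) + 2 = 4 * m + 4)%N by lia.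
rewrite {}IH => wp_rec.
have c0 : (2 * (2 * m + 1) + 1)%:R != 0 :> F by rewrite pnatr_eq0; lia.
apply: (mulfI (mulf_neq0 c0 (y_even2 m.+1))); rewrite {}wp_rec.
rewrite [\prod_(j < m.+1) (_ - y) in RHS]big_ord_recr.
rewrite [\prod_(j < m.+2) _]big_ord_recr /=.
have Q0 : \prod_(j < m.+1) ((4 * j + 2)%:R ^+ 2 - y) != 0 by apply/prodf_neq0.
move: Q0 (y_even2 m.+1); set Q := \prod_(j < m.+1) _.
move: ((4 * m.+1 + 2)%:R ^+ 2 - y) => R Q0 R0.
by field; rewrite Q0 R0.
Qed.
End WellPoisedSum.


(** * Congruences between p-integral rationals *)

(** The local ring [Z_(p)]: congruences are proved among rationals and carried to the p-adic
    integers only at the end. *)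
Definition p_integral (p : nat) (p_pr : prime p) : {pred rat} :=
  fun x => coprime p `|denq x|.

Section PIntegral.
Variables (p : nat) (p_pr : prime p).
Local Notation Zloc := (p_integral p_pr).
Implicit Types (x y u v : rat) (m k : nat).

Lemma coprime_neq0 (b : nat) : coprime p b -> b != 0%N.
Proof.
by case: b => //; rewrite /coprime gcdn0 => /eqP p1; move: p_pr; rewrite p1.
Qed.

Lemma p_integralP x :
  reflect (exists a b : int, coprime p `|b| /\ x = a%:~R / b%:~R) (x \in Zloc).
Proof.
apply: (iffP idP) => [xZ|[a [b [pb xab]]]].
  by exists (numq x), (denq x); rewrite divq_num_den.
have b0 : b != 0 by rewrite -absz_eq0 coprime_neq0.
(* By Gauss, the reduced denominator divides every other denominator. *)
have : (denq x %| b)%Z.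
  rewrite -(@Gauss_dvdzr _ (numq x)); last first.
    by rewrite /coprimez gcdzC; apply: coprime_num_den.
  apply/dvdzP; exists a; apply/eqP; rewrite -(eqr_int rat) !intrM numqE xab.
  by rewrite mulrAC mulfVK ?intr_eq0.
by rewrite dvdzE => /coprime_dvdr; apply.
Qed.

Fact p_integral_subring : subring_closed Zloc.
Proof.
split.
- by apply/p_integralP; exists 1, 1; rewrite coprimen1 divr1.
- move=> x y /p_integralP[a [b [pb ->]]] /p_integralP[c [d [pd ->]]].
  apply/p_integralP; exists (a * d - c * b), (b * d).
  rewrite abszM coprimeMr pb pd; split=> //.
  have b0 : b%:~R != 0 :> rat by rewrite intr_eq0 -absz_eq0 coprime_neq0.
  have d0 : d%:~R != 0 :> rat by rewrite intr_eq0 -absz_eq0 coprime_neq0.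
  by field; rewrite b0 d0.
- move=> x y /p_integralP[a [b [pb ->]]] /p_integralP[c [d [pd ->]]].
  apply/p_integralP; exists (a * c), (b * d).
  by rewrite abszM coprimeMr pb pd !intrM mulf_div.
Qed.

HB.instance Definition _ := GRing.isSubringClosed.Build rat Zloc p_integral_subring.

Definition p_unit : {pred rat} := fun x => [&& x != 0, x \in Zloc & x^-1 \in Zloc].

Lemma p_unit_neq0 x : x \in p_unit -> x != 0.
Proof. by case/and3P. Qed.

Lemma p_unit_integral x : x \in p_unit -> x \in Zloc.
Proof. by case/and3P. Qed.

Lemma p_unitV x : x \in p_unit -> x^-1 \in p_unit.
Proof. by case/and3P=> x0 xZ xV; apply/and3P; rewrite invrK invr_eq0. Qed.

Lemma p_unitM x y : x \in p_unit -> y \in p_unit -> x * y \in p_unit.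
Proof.
case/and3P=> x0 xZ xV /and3P[y0 yZ yV]; apply/and3P.
by rewrite mulf_neq0 // invfM !rpredM.
Qed.

Lemma p_unit1 : 1 \in p_unit.
Proof. by apply/and3P; rewrite invr1 rpred1 oner_eq0. Qed.

Lemma p_unitX x k : x \in p_unit -> x ^+ k \in p_unit.
Proof.
by move=> xU; elim: k => [|k IH]; rewrite ?p_unit1 // exprS p_unitM.
Qed.

Lemma p_unit_prod (I : Type) (r : seq I) (P : pred I) (f : I -> rat) :
  (forall i, P i -> f i \in p_unit) -> \prod_(i <- r | P i) f i \in p_unit.
Proof.
by move=> fU; apply: (big_ind (fun x => x \in p_unit)) fU;
  [exact: p_unit1 | exact: p_unitM].
Qed.

Lemma p_unit_nat (a : nat) : coprime p a -> a%:R \in p_unit.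
Proof.
move=> pa; apply/and3P; rewrite pnatr_eq0 coprime_neq0 // rpred_nat; split=> //.
by apply/p_integralP; exists 1, a%:Z; rewrite mul1r.
Qed.

Lemma p_unit_small (a : nat) : (0 < a < p)%N -> a%:R \in p_unit.
Proof.
case/andP=> a0 ap; apply: p_unit_nat; rewrite prime_coprime //.
by apply/negP => /dvdn_leq; lia.
Qed.

(** Only the difference must lie in [p^m Z_(p)]; integrality of [x] and [y] is requested separately,
    where multiplication uses it. *)
Definition eqmodp m x y := (x - y) / p%:R ^+ m \in Zloc.

Let p0 : p%:R != 0 :> rat.
Proof. by rewrite pnatr_eq0 -lt0n prime_gt0. Qed.

Lemma eqmodpP m x y :
  reflect (exists2 c, c \in Zloc & x = y + p%:R ^+ m * c) (eqmodp m x y).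
Proof.
have pm0 : p%:R ^+ m != 0 :> rat by rewrite expf_neq0.
apply: (iffP idP) => [xy|[c cZ ->]].
  by exists ((x - y) / p%:R ^+ m); rewrite // [_ * (_ / _)]mulrC divfK // addrC subrK.
by rewrite /eqmodp addrAC subrr add0r mulrAC divff // mul1r.
Qed.

Lemma eqmodp_refl m x : eqmodp m x x.
Proof. by rewrite /eqmodp subrr mul0r rpred0. Qed.

Lemma eqmodp_sym m x y : eqmodp m x y -> eqmodp m y x.
Proof. by rewrite /eqmodp -opprB mulNr rpredN. Qed.

Lemma eqmodp_trans m y x z : eqmodp m x y -> eqmodp m y z -> eqmodp m x z.
Proof. by rewrite /eqmodp => xy yz; rewrite -(subrK y x) -addrA mulrDl rpredD. Qed.

Lemma eqmodpD m x y x' y' :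
  eqmodp m x x' -> eqmodp m y y' -> eqmodp m (x + y) (x' + y').
Proof. by rewrite /eqmodp => xx yy; rewrite opprD addrACA mulrDl rpredD. Qed.

Lemma eqmodpN m x x' : eqmodp m x x' -> eqmodp m (- x) (- x').
Proof. by rewrite /eqmodp -opprD mulNr rpredN. Qed.

Lemma eqmodpB m x y x' y' :
  eqmodp m x x' -> eqmodp m y y' -> eqmodp m (x - y) (x' - y').
Proof. by move=> xx yy; apply: eqmodpD => //; apply: eqmodpN. Qed.

Lemma eqmodpM m x y x' y' : y \in Zloc -> x' \in Zloc ->
  eqmodp m x x' -> eqmodp m y y' -> eqmodp m (x * y) (x' * y').
Proof.
rewrite /eqmodp => yZ xZ xx yy.
have -> : x * y - x' * y' = (x - x') * y + x' * (y - y') by ring.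
by rewrite mulrDl mulrAC -[x' * _ / _]mulrA rpredD // rpredM.
Qed.

Lemma eqmodpMl m z x y : z \in Zloc -> eqmodp m x y -> eqmodp m (z * x) (z * y).
Proof. by rewrite /eqmodp -mulrBr -mulrA => zZ xy; rewrite rpredM. Qed.

Lemma eqmodpMr m z x y : z \in Zloc -> eqmodp m x y -> eqmodp m (x * z) (y * z).
Proof. by rewrite ![_ * z]mulrC; apply: eqmodpMl. Qed.

Lemma eqmodp_integral m x y : eqmodp m x y -> y \in Zloc -> x \in Zloc.
Proof. by case/eqmodpP=> c cZ -> yZ; rewrite rpredD // rpredM // rpredX // rpred_nat. Qed.

Lemma eqmodpX m x y k : y \in Zloc -> eqmodp m x y -> eqmodp m (x ^+ k) (y ^+ k).
Proof.
move=> yZ xy; elim: k => [|k IH]; first exact: eqmodp_refl.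
by rewrite !exprS; apply: eqmodpM => //; rewrite rpredX // (eqmodp_integral xy).
Qed.

Lemma eqmodp_sum m (I : Type) (r : seq I) (P : pred I) (f g : I -> rat) :
  (forall i, P i -> eqmodp m (f i) (g i)) ->
  eqmodp m (\sum_(i <- r | P i) f i) (\sum_(i <- r | P i) g i).
Proof.
by move=> fg; apply: (big_ind2 (eqmodp m)) => //;
  [exact: eqmodp_refl | move=> *; exact: eqmodpD].
Qed.

Lemma eqmodp_prod m (I : Type) (r : seq I) (P : pred I) (f g : I -> rat) :
  (forall i, P i -> g i \in Zloc) ->
  (forall i, P i -> eqmodp m (f i) (g i)) ->
  eqmodp m (\prod_(i <- r | P i) f i) (\prod_(i <- r | P i) g i).
Proof.
move=> gZ fg.
have [] // : \prod_(i <- r | P i) g i \in Zloc /\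
  eqmodp m (\prod_(i <- r | P i) f i) (\prod_(i <- r | P i) g i).
apply: (big_ind2 (fun x y => y \in Zloc /\ eqmodp m x y))
  => [|x x' y y' [Z1 E1] [Z2 E2]|i Pi].
- by rewrite rpred1 eqmodp_refl.
- by rewrite rpredM //; split=> //; apply: eqmodpM => //; apply: eqmodp_integral E2 _.
- by split; [apply: gZ | apply: fg].
Qed.

(** This turns a prefactor [p^k] into precision: [p^4] leaves work modulo [p], and [p^3] leaves work
    modulo [p^2]. *)
Lemma eqmodp_scale k m x y :
  eqmodp m x y -> eqmodp (k + m) (p%:R ^+ k * x) (p%:R ^+ k * y).
Proof.
case/eqmodpP=> c cZ ->; apply/eqmodpP; exists c => //.
by rewrite mulrDr exprD mulrA.
Qed.

Lemma eqmodp_weaken k m x y : (k <= m)%N -> eqmodp m x y -> eqmodp k x y.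
Proof.
move=> km /eqmodpP[c cZ ->]; apply/eqmodpP; exists (p%:R ^+ (m - k) * c).
  by rewrite rpredM ?rpredX ?rpred_nat.
by rewrite mulrA -exprD subnKC.
Qed.

Lemma eqmodp_addMr m k x c : (m <= k)%N -> c \in Zloc -> eqmodp m (x + p%:R ^+ k * c) x.
Proof.
by move=> mk cZ; apply: (eqmodp_weaken mk); apply/eqmodpP; exists c.
Qed.

Lemma eqmodp_cancel m u x y : u \in p_unit ->
  eqmodp m (u * x) (u * y) -> eqmodp m x y.
Proof.
case/and3P=> u0 _ uV /(eqmodpMl uV); by rewrite !mulKf.
Qed.

Lemma eqmodpV m x y : x \in p_unit -> y \in p_unit ->
  eqmodp m x y -> eqmodp m x^-1 y^-1.
Proof.
move=> xU yU xy; apply: (eqmodp_cancel (p_unitM xU yU)).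
rewrite mulrAC divff ?p_unit_neq0 // mul1r mulfK ?p_unit_neq0 //.
exact: eqmodp_sym.
Qed.

Lemma eqmodp_int m (a b : int) :
  reflect (eqmodp m a%:~R b%:~R) (p%:Z ^+ m %| a - b)%Z.
Proof.
apply: (iffP idP) => [/dvdzP[c abc] | /eqmodpP[c /p_integralP[s [t [pt ->]]] abE]].
  apply/eqmodpP; exists c%:~R; first by rewrite rpred_int.
  by rewrite -[in RHS]/(p%:~R) -rmorphXn -intrM -intrD mulrC -abc addrC subrK.
have t0 : t%:~R != 0 :> rat by rewrite intr_eq0 -absz_eq0 coprime_neq0.
rewrite -(@Gauss_dvdzl _ _ t); last first.
  by rewrite coprimezE abszX coprimeXl.
apply/dvdzP; exists s; apply/eqP; rewrite -(eqr_int rat) !intrM intrB abE rmorphXn /=.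
by apply/eqP; rewrite -pmulrn; field.
Qed.

(** Write [x / y] as [s / t] with [t] prime to [p]. It is 1 modulo [p], so [s] and [t] agree modulo
    [p] and [s] is prime to [p] too. *)
Lemma eqmodp_unit m x y : (0 < m)%N -> y \in p_unit -> eqmodp m x y -> x \in p_unit.
Proof.
move=> m0 yU xy.
have xZ := eqmodp_integral xy (p_unit_integral yU).
have /eqmodpP[c cZ xyE] := eqmodp_weaken m0 xy.
have [/p_integralP[s [t [pt uE]]]] : x / y \in Zloc /\ eqmodp 1 (x / y) 1.
  have [y0 yZ yV] := and3P yU; rewrite rpredM //; split=> //.
  apply/eqmodpP; exists (c / y); first by rewrite rpredM.
  by rewrite xyE; field.
have t0 : t%:~R != 0 :> rat by rewrite intr_eq0 -absz_eq0 coprime_neq0.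
rewrite uE => /(eqmodpMr (rpred_int _ t)); rewrite divfK // mul1r => /eqmodp_int st.
have ps : coprime p `|s|.
  rewrite prime_coprime //; apply: contraL pt => ps.
  rewrite prime_coprime // negbK.
  have : (p%:Z %| s - (s - t))%Z by rewrite rpredB.
  by rewrite opprB addrCA subrr addr0.
have s0 : s%:~R != 0 :> rat by rewrite intr_eq0 -absz_eq0 coprime_neq0.
suff /p_unitM/(_ yU) : x / y \in p_unit by rewrite divfK ?p_unit_neq0.
rewrite uE; apply/and3P; rewrite mulf_neq0 ?invr_neq0 // invf_div; split=> //.
  by apply/p_integralP; exists s, t.
by apply/p_integralP; exists t, s.
Qed.

End PIntegral.


(** * Deformation of the truncated sum modulo p^5 *)

Section HalfRange.
Variables (p n : nat) (p_pr : prime p) (p_def : p = (2 * n + 1)%N).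
Local Notation Zloc := (p_integral p_pr).
Local Notation unit_p := (p_unit p_pr).
Local Notation eqm := (eqmodp p_pr).
Local Notation oe := (odd_even_ratio rat).
Local Notation sr := (@shifted_ratio rat).

Lemma p_unit_odd i : (i < n)%N -> (2 * i + 1)%:R \in unit_p.
Proof. by move=> lt_in; apply: p_unit_small; lia. Qed.

Lemma p_unit_even i : (i < n)%N -> (2 * i + 2)%:R \in unit_p.
Proof. by move=> lt_in; apply: p_unit_small; lia. Qed.

(* The logarithmic derivative, at [t = 0], of the product over [i < k] of
   [((2i+1)^4 - t) / ((2i+2)^4 - t)]. *)
Definition quartic_sum k : rat :=
  \sum_(i < k) ((2 * i + 2)%:R ^- 4 - (2 * i + 1)%:R ^- 4).

Lemma quartic_sumS k : quartic_sum k.+1 =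
  quartic_sum k + ((2 * k + 2)%:R ^- 4 - (2 * k + 1)%:R ^- 4).
Proof. by rewrite /quartic_sum big_ord_recr. Qed.

Lemma quartic_sum_integral k : (k <= n)%N -> quartic_sum k \in Zloc.
Proof.
move=> le_kn; apply: rpred_sum => i _.
have lt_in : (i < n)%N by apply: leq_trans (ltn_ord i) le_kn.
by apply: rpredB; apply: p_unit_integral; apply: p_unitV; apply: p_unitX;
  [exact: p_unit_even | exact: p_unit_odd].
Qed.

Lemma odd_even_ratio_integral k : (k <= n)%N -> oe k \in Zloc.
Proof.
move=> le_kn; apply: rpred_prod => i _.
have lt_in : (i < n)%N by apply: leq_trans (ltn_ord i) le_kn.
apply: p_unit_integral; apply: p_unitM; first exact: p_unit_odd.
by apply: p_unitV; exact: p_unit_even.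
Qed.

(** With [u = 2i+1] and [v = 2i+2], the two factors multiply to [(u^4 - p^4) / (v^4 - p^4)], which
    is [(u/v)^4 (1 + p^4 w)] with [w] congruent to [v^-4 - u^-4] modulo [p]. *)
Lemma shifted_ratio_expansion k : (k <= n)%N ->
  exists z, [/\ z \in Zloc, eqm 1 z (quartic_sum k) &
    sr (- p%:R ^+ 2) k * sr (p%:R ^+ 2) k = oe k ^+ 4 * (1 + p%:R ^+ 4 * z)].
Proof.
elim: k => [|k IH] le_kn.
  exists 0; rewrite /quartic_sum /shifted_ratio /odd_even_ratio !big_ord0.
  by rewrite rpred0 eqmodp_refl mulr0 addr0 expr1n.
have [z [zZ zE zprod]] := IH (ltnW le_kn).
rewrite quartic_sumS !shifted_ratioS odd_even_ratioS.
move: (p_unit_odd le_kn) (p_unit_even le_kn).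
move: (2 * k + 1)%:R (2 * k + 2)%:R => u v uU vU.
have pZ j : p%:R ^+ j \in Zloc by rewrite rpredX // rpred_nat.
have vp : eqm 1 (v ^+ 4 - p%:R ^+ 4) (v ^+ 4).
  rewrite -{2}[v ^+ 4]subr0; apply: eqmodpB; first exact: eqmodp_refl.
  by apply/eqmodpP; exists (p%:R ^+ 3); rewrite // add0r -exprS.
have vpU : v ^+ 4 - p%:R ^+ 4 \in unit_p.
  by apply: eqmodp_unit vp => //; apply: p_unitX.
have [u0 uZ _] := and3P uU; have [v0 vZ _] := and3P vU.
have vp0 := p_unit_neq0 vpU.
pose w := (u ^+ 4 - v ^+ 4) / (u ^+ 4 * (v ^+ 4 - p%:R ^+ 4)).
have uvZ : u ^+ 4 - v ^+ 4 \in Zloc by rewrite rpredB ?rpredX.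
have wZ : w \in Zloc.
  by rewrite rpredM // (p_unit_integral (p_unitV (p_unitM (p_unitX _ uU) vpU))).
have wE : eqm 1 w (v ^- 4 - u ^- 4).
  have -> : v ^- 4 - u ^- 4 = (u ^+ 4 - v ^+ 4) / (u ^+ 4 * v ^+ 4).
    by field; rewrite u0 v0.
  apply: eqmodpMl => //; apply: eqmodpV; rewrite ?p_unitM ?p_unitX //.
  by apply: eqmodpMl => //; rewrite rpredX.
(* From expanding [(1 + p^4 z)(1 + p^4 w)]. *)
exists (z + w + p%:R ^+ 4 * (z * w)); split.
- by apply: rpredD; [exact: rpredD | apply: rpredM; [exact: pZ | exact: rpredM]].
- apply: eqmodp_trans (eqmodpD zE wE).
  by apply: eqmodp_addMr => //; exact: rpredM.
- rewrite mulrACA zprod /w.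
  have pp0 : v ^+ 2 - p%:R ^+ 2 != 0 /\ v ^+ 2 + p%:R ^+ 2 != 0.
    by apply/andP; rewrite -negb_or -mulf_eq0 -subr_sqr -!exprM.
  by field; rewrite opprK u0 v0 vp0; case: pp0 => -> ->.
Qed.

(** Since [2i+1 = p - 2(n-i)], the odd fourth powers are the even ones read backwards modulo [p].
    The resulting form is visibly symmetric under [k |-> n - k]. *)
Lemma quartic_sum_split k : (k <= n)%N ->
  eqm 1 (quartic_sum k)
    (\sum_(i < k) (2 * i + 2)%:R ^- 4 + \sum_(i < n - k) (2 * i + 2)%:R ^- 4
     - \sum_(i < n) (2 * i + 2)%:R ^- 4).
Proof.
elim: k => [|k IH] le_kn.
  by rewrite /quartic_sum !big_ord0 subn0 add0r subrr eqmodp_refl.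
rewrite quartic_sumS big_ord_recr /=.
move: (IH (ltnW le_kn)).
set h := \sum_(i < k) _; set h' := \sum_(i < n) _ => {}IH.
have nk : (n - k = (n - k.+1).+1)%N by lia.
move: IH; rewrite nk big_ord_recr /=.
set g := \sum_(i < _) _; set v := _ ^- 4; set w := (2 * k + 2)%:R ^- 4 => IH.
have vu : eqm 1 v ((2 * k + 1)%:R ^- 4).
  apply: eqmodpV; rewrite ?p_unitX ?p_unit_odd ?p_unit_even //; first by lia.
  have -> : (2 * k + 1)%:R ^+ 4 = (- (2 * k + 1)%:R) ^+ 4 :> rat by ring.
  apply: eqmodpX; first by rewrite rpredN rpred_nat.
  apply/eqmodpP; exists 1; rewrite ?rpred1 // expr1 mulr1 addrC -natrB; last by lia.
  by congr _%:R; lia.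
have -> : h + w + g - h' = h + (g + v) - h' + (w - v) by ring.
exact: eqmodpD IH (eqmodpB (eqmodp_refl _ _ _) (eqmodp_sym vu)).
Qed.

Lemma quartic_sum_sym k : (k <= n)%N ->
  eqm 1 (quartic_sum (n - k)) (quartic_sum k).
Proof.
move=> le_kn; apply: eqmodp_trans (quartic_sum_split (leq_subr _ _)) _.
rewrite subKn // [X in eqm _ (X - _)]addrC.
exact: eqmodp_sym (quartic_sum_split _).
Qed.

(** Modulo [p], [1/2] is [-n], so [(1/2)_k / k!] becomes [(-n)_k / k!]. *)
Lemma odd_even_ratio_bin k : (k <= n)%N ->
  eqm 1 (oe k) ((-1) ^+ k * 'C(n, k)%:R).
Proof.
elim: k => [|k IH] le_kn.
  by rewrite /odd_even_ratio big_ord0 bin0 mulr1 eqmodp_refl.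
rewrite odd_even_ratioS.
have vU : (2 * k + 2)%:R \in unit_p by exact: p_unit_even.
apply: (eqmodp_cancel vU).
rewrite [_ * (_ / _)]mulrA mulrCA divff ?mulr1; last exact: p_unit_neq0 vU.
have -> : (2 * k + 2)%:R * ((-1) ^+ k.+1 * 'C(n, k.+1)%:R) =
    (-1) ^+ k * 'C(n, k)%:R * - (2 * (n - k))%:R :> rat.
  have : (2 * k + 2)%:R * 'C(n, k.+1)%:R = 'C(n, k)%:R * (2 * (n - k))%:R :> rat.
    by rewrite -!natrM; congr _%:R; have := mul_bin_left n k; lia.
  rewrite exprS mulrCA => ->; ring.
have pZ j : (-1) ^+ j \in Zloc by rewrite rpredX // rpredN rpred1.
apply: eqmodpM (IH (ltnW le_kn)) _; rewrite ?rpred_nat //.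
  by apply: rpredM; rewrite ?rpred_nat ?pZ.
apply/eqmodpP; exists 1; rewrite ?rpred1 // expr1 mulr1 addrC -natrB; last by lia.
by congr _%:R; lia.
Qed.

Hypotheses (odd_n : odd n) (p_gt2 : (2 < p)%N).

(** Symmetry of the binomial coefficients, with the sign [(-1)^n = -1]. *)
Lemma odd_even_ratio_sym k : (k <= n)%N -> eqm 1 (oe (n - k)) (- oe k).
Proof.
move=> le_kn; apply: eqmodp_trans (odd_even_ratio_bin (leq_subr _ _)) _.
have -> : (-1) ^+ (n - k) * 'C(n, n - k)%:R = - ((-1) ^+ k * 'C(n, k)%:R) :> rat.
  by rewrite bin_sub // -signr_odd oddB // odd_n signrN signr_odd mulNr.
by apply: eqmodpN; apply: eqmodp_sym; exact: odd_even_ratio_bin.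
Qed.

(* Modulo [p] the summand is antisymmetric under [k |-> n - k]. *)
Lemma weighted_quartic_sum_eq0 :
  eqm 1 (\sum_(k < n.+1) (-1) ^+ k * (4 * k + 1)%:R * oe k ^+ 5 * quartic_sum k) 0.
Proof.
set f := fun k : nat => (-1) ^+ k * (4 * k + 1)%:R * oe k ^+ 5 * quartic_sum k : rat.
have f_sym (k : 'I_n.+1) : eqm 1 (f (n - k)%N) (- f k).
  have le_kn : (k <= n)%N by rewrite -ltnS.
  have -> : f (n - k)%N = - (-1) ^+ k * (4 * (n - k) + 1)%:R * oe (n - k) ^+ 5
      * quartic_sum (n - k).
    by rewrite /f -[(-1) ^+ (n - k)]signr_odd oddB // odd_n signrN signr_odd.
  have -> : - f k = - (-1) ^+ k * - (4 * k + 1)%:R * (- oe k) ^+ 5 * quartic_sum k.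
    by rewrite /f; ring.
  have oeZ := odd_even_ratio_integral le_kn.
  have sgZ : - (-1) ^+ k \in Zloc by rewrite rpredN rpredX // rpredN rpred1.
  have lZ : - (4 * k + 1)%:R \in Zloc by rewrite rpredN rpred_nat.
  apply: eqmodpM (quartic_sum_sym le_kn); first exact/quartic_sum_integral/leq_subr.
    by apply: rpredM; [exact: rpredM | rewrite rpredX // rpredN].
  apply: eqmodpM; [|by rewrite rpredM| |].
  - by rewrite rpredX // odd_even_ratio_integral // leq_subr.
  (* [4(n-k) + 1 = 2p - (4k+1)]. *)
  - apply: eqmodpMl => //; apply/eqmodpP; exists 2; first exact: rpred_nat.
    rewrite expr1 p_def addrC -natrM -natrB; last by lia.
    by congr _%:R; lia.
  - by apply: eqmodpX; [rewrite rpredN | exact: odd_even_ratio_sym].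
(* Three sign changes (the alternating sign, the linear factor, the fifth power) make the sum its
   own negative modulo [p]; 2 is then cancelled. *)
have sumN : eqm 1 (\sum_(k < n.+1) f k) (- \sum_(k < n.+1) f k).
  rewrite {1}(reindex_inj rev_ord_inj) -sumrN.
  by apply: eqmodp_sum => k _; rewrite /= subSS; exact: f_sym.
have twoU : 2%:R \in unit_p by apply: p_unit_small.
apply: (eqmodp_cancel twoU); rewrite mulr0 mulr_natl mulr2n.
move: (eqmodpD sumN (eqmodp_refl p_pr 1 (\sum_(k < n.+1) f k))).
by rewrite addNr.
Qed.

Lemma truncated_sum_deformation :
  eqm 5 (\sum_(k < n.+1) (-1) ^+ k * (4 * k + 1)%:R * oe k ^+ 5)
    (well_poised_sum n (- p%:R ^+ 2)).
Proof.
apply: eqmodp_sym.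
have [z zP] := fin_all_exists (fun k : 'I_n.+1 =>
  @shifted_ratio_expansion k (ltn_ord k)).
pose t (k : 'I_n.+1) := (-1) ^+ k * (4 * k + 1)%:R * oe k ^+ 5.
have -> : well_poised_sum n (- p%:R ^+ 2) =
    \sum_(k < n.+1) t k + p%:R ^+ 4 * \sum_(k < n.+1) t k * z k.
  rewrite mulr_sumr -big_split /=; apply: eq_bigr => k _.
  have [_ _ zprod] := zP k.
  by rewrite /well_poised_term -p_def -mulrA zprod /t; ring.
(* The error term is [p^4] times a sum, which therefore only has to vanish modulo [p]. *)
rewrite -[X in eqm 5 _ X]addr0 -[X in eqm 5 _ (_ + X)](mulr0 (p%:R ^+ 4)).
apply: eqmodpD; first exact: eqmodp_refl.
apply: (@eqmodp_scale _ _ 4 1); apply: eqmodp_trans weighted_quartic_sum_eq0.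
apply: eqmodp_sum => k _; have [_ zE _] := zP k.
apply: eqmodpMl => //; apply: rpredM.
  by rewrite rpredM ?rpredX ?rpredN ?rpred1 ?rpred_nat.
by rewrite rpredX // odd_even_ratio_integral // -ltnS.
Qed.
End HalfRange.


(** At [y = -p^2] the closed form has the prefactor [-p^3], so the remaining quotient matters modulo
    [p^2] only, where [y] drops out. Its denominators are units because [4m+2 < p]. *)
Lemma truncated_sum_product (p m : nat) (p_pr : prime p) :
  p = (4 * m + 3)%N ->
  eqmodp p_pr 5
    (\sum_(k < (2 * m + 1).+1)
       (-1) ^+ k * (4 * k + 1)%:R * odd_even_ratio rat k ^+ 5)
    (- p%:R ^+ 3 * ((\prod_(j < m) (4 * j + 4)%:R ^+ 2)
                    / \prod_(j < m.+1) (4 * j + 2)%:R ^+ 2)).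
Proof.
move=> p_def; have p_n : p = (2 * (2 * m + 1) + 1)%N by lia.
have odd_n : odd (2 * m + 1) by lia.
have p_gt2 : (2 < p)%N by lia.
apply: eqmodp_trans (truncated_sum_deformation p_pr p_n odd_n p_gt2) _.
(* A sum of two squares, hence positive. *)
have y_even (i : nat) : (2 * i + 2)%:R ^+ 2 - - p%:R ^+ 2 != 0 :> rat.
  by rewrite opprK gt_eqF // ltr_pwDl ?exprn_ge0 ?exprn_gt0 // ltr0n; lia.
rewrite well_poised_sum_odd // -p_def.
have -> : p%:R * - p%:R ^+ 2 = - p%:R ^+ 3 :> rat by ring.
rewrite -[X in eqmodp _ _ X]mulrA !mulNr; apply: eqmodpN; apply: (@eqmodp_scale _ _ 3 2).
have shift_eq (a : nat) : eqmodp p_pr 2 (a%:R ^+ 2 - - p%:R ^+ 2) (a%:R ^+ 2).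
  by apply/eqmodpP; exists 1; rewrite ?rpred1 // opprK mulr1.
have sqZ (a : nat) : a%:R ^+ 2 \in p_integral p_pr by rewrite rpredX // rpred_nat.
have unit_small (a : nat) : (0 < a < p)%N -> a%:R ^+ 2 \in p_unit p_pr.
  by move=> ap; rewrite p_unitX // p_unit_small.
have unitO (j : 'I_m.+1) : (4 * j + 2)%:R ^+ 2 \in p_unit p_pr.
  by apply: unit_small; have := ltn_ord j; lia.
apply: eqmodpM.
- apply: p_unit_integral; apply: p_unitV; apply: p_unit_prod => j _.
  exact: eqmodp_unit (shift_eq _).
- by apply: rpred_prod.
- by apply: eqmodp_prod => j _.
apply: eqmodpV; last by apply: eqmodp_prod => j _.
  by apply: p_unit_prod => j _; apply: eqmodp_unit (shift_eq _).
by apply: p_unit_prod => j _.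
Qed.


(** * Factorials without multiples of p *)

Section UnitFactorial.
Variables (p : nat) (p_pr : prime p).
Local Notation Zloc := (p_integral p_pr).
Local Notation unit_p := (p_unit p_pr).
Local Notation eqm := (eqmodp p_pr).

(** A second-order Taylor expansion. The linear coefficient [b] is chosen before [z], so different
    shifts can be compared. *)
Lemma prod_shift_expansion (I : Type) (r : seq I) (P : pred I) (f : I -> rat) :
    (forall i, P i -> f i \in Zloc) ->
  exists2 b, b \in Zloc & forall z, z \in Zloc -> exists2 c, c \in Zloc &
    \prod_(i <- r | P i) (f i + z)
    = \prod_(i <- r | P i) f i + z * b + z ^+ 2 * c.
Proof.
move=> fZ; elim: r => [|i r [b bZ IH]].
  exists 0; rewrite ?rpred0 // => z zZ; exists 0; rewrite ?rpred0 //.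
  by rewrite !big_nil !mulr0 !addr0.
case Pi: (P i); last first.
  exists b => // z zZ; have [c cZ E] := IH z zZ; exists c => //.
  by rewrite !big_cons Pi.
have fiZ := fZ i Pi; have prodZ : \prod_(j <- r | P j) f j \in Zloc by apply: rpred_prod.
exists (f i * b + \prod_(j <- r | P j) f j); first by rewrite rpredD // rpredM.
move=> z zZ; have [c cZ E] := IH z zZ.
exists (f i * c + b + z * c); first by rewrite !rpredD // rpredM.
by rewrite !big_cons Pi E; ring.
Qed.

(** Morita's product without its sign. Starting at 0, itself a multiple of [p] and so skipped, makes
    the blocks uniform. *)
Definition unit_fact (n : nat) : rat := \prod_(0 <= c < n | ~~ (p %| c)%N) c%:R.

Definition unit_block (q : nat) (z : rat) : rat :=
  \prod_(0 <= c < q | ~~ (p %| c)%N) (c%:R + z).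

Lemma unit_factD (a n : nat) : (p %| a)%N ->
  unit_fact (a + n) = unit_fact a * unit_block n a%:R.
Proof.
move=> pa; rewrite /unit_fact (@big_cat_nat _ _ _ a) ?leq_addr //=; congr (_ * _).
rewrite -{1}[a]add0n big_addn addKn; apply: eq_big => [c | c _].
  by rewrite dvdn_addl.
by rewrite natrD.
Qed.

Lemma unit_fact_blocks (t q : nat) : (p %| q)%N ->
  unit_fact (t * q) = \prod_(i < t) unit_block q (i * q)%:R.
Proof.
move=> pq; elim: t => [|t IH].
  by rewrite mul0n /unit_fact big_geq // big_ord0.
by rewrite mulSn addnC unit_factD ?dvdn_mull // IH big_ord_recr.
Qed.

Lemma unit_fact_unit n : unit_fact n \in unit_p.
Proof. by apply: p_unit_prod => c pc; apply: p_unit_nat; rewrite prime_coprime. Qed.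

Lemma unit_block_integral q z : z \in Zloc -> unit_block q z \in Zloc.
Proof. by move=> zZ; apply: rpred_prod => c _; rewrite rpredD // rpred_nat. Qed.

Hypothesis p_gt2 : (2 < p)%N.

(* The reflection [c |-> p^k - c]; it forces the linear term of [unit_block] at
   [0] to vanish modulo [p^k]. *)
Lemma unit_block_opp k : (0 < k)%N ->
  unit_block (p ^ k) (- (p ^ k)%:R) = unit_fact (p ^ k).
Proof.
move=> k0; set q := (p ^ k)%N.
have pq : (p %| q)%N by rewrite dvdn_exp.
have q0 : (0 < q)%N by rewrite expn_gt0 prime_gt0.
pose s : rat := \prod_(1 <= c < q | ~~ (p %| c)%N) -1.
have blockE : unit_block q (- q%:R) = s * unit_fact q.
  rewrite /unit_block /unit_fact !(@big_ltn_cond _ _ _ 0 q) ?dvdn0 //=.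
  rewrite /s -big_split /= [LHS]big_nat_rev big_nat_cond [RHS]big_nat_cond.
  apply: eq_big => [c | c /andP[/andP[c1 cq] _]].
    case: (ltnP c q) => cq; rewrite ?andbF // add1n subSS !andbT.
    by rewrite dvdn_subr // ltnW.
  by rewrite add1n subSS natrB; [ring | exact: ltnW].
(* The sign [s] is not found by counting factors: [s = -1] would make a unit congruent to its
   negative modulo the odd prime [p]. *)
have s2 : s = 1 \/ s = -1.
  rewrite /s; apply: (big_ind (fun x : rat => x = 1 \/ x = -1)); first by left.
    by move=> x y [] -> [] ->; rewrite ?mulrNN ?mulr1 ?mul1r; auto.
  by right.
case: s2 blockE => [-> -> | ->]; first by rewrite mul1r.
rewrite mulN1r => blockN; exfalso.
have : eqm 1 (- unit_fact q) (unit_fact q).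
  rewrite -blockN; apply: eqmodp_prod => c _; first exact: rpred_nat.
  apply/eqmodpP; exists (- (p ^ k.-1)%:R); first by rewrite rpredN rpred_nat.
  by rewrite mulrN expr1 -natrM -expnS prednK.
have [_ _ fV] := and3P (unit_fact_unit q).
rewrite -[X in eqm 1 _ X]mulr1 -mulrN1 => /(eqmodp_cancel (unit_fact_unit q)).
move=> /(@eqmodp_int _ p_pr 1 (-1) 1); rewrite expr1 dvdzE /= => /dvdn_leq; lia.
Qed.

(** Put [q = p^k]. Equal values at the shifts 0 and [-q] force [b = q c], so at a shift by [i q]
    both correction terms are divisible by [q^2]. *)
Lemma unit_block_mod k i : (0 < k)%N ->
  eqm (2 * k) (unit_block (p ^ k) (i * p ^ k)%:R) (unit_fact (p ^ k)).
Proof.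
move=> k0; have fZ (c : nat) : ~~ (p %| c)%N -> c%:R \in Zloc by rewrite rpred_nat.
have [b bZ bE] := prod_shift_expansion (index_iota 0 (p ^ k)) fZ.
have q0 : (p ^ k)%:R != 0 :> rat by rewrite pnatr_eq0 -lt0n expn_gt0 prime_gt0.
have [|c cZ] := bE (- (p ^ k)%:R); first by rewrite rpredN rpred_nat.
rewrite -/(unit_block _ _) -/(unit_fact _) unit_block_opp // => cE.
have {}cE : b = (p ^ k)%:R * c.
  by apply: (mulfI q0); lra.
have [|d dZ] := bE (i * p ^ k)%:R; first by rewrite rpred_nat.
rewrite -/(unit_block _ _) -/(unit_fact _) cE => ->; apply/eqmodpP.
exists (i%:R * c + i%:R ^+ 2 * d); first by rewrite rpredD // rpredM ?rpredX ?rpred_nat.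
by rewrite natrM natrX mulnC exprM; ring.
Qed.

(** In [x^p - y^p = (x - y) * sum], the sum is [p y^(p-1)] modulo [p] and supplies one more factor
    [p]. *)
Lemma eqmodp_frobenius k x y : (0 < k)%N -> y \in Zloc ->
  eqm k x y -> eqm k.+1 (x ^+ p) (y ^+ p).
Proof.
move=> k0 yZ xy; have xZ := eqmodp_integral xy yZ.
rewrite /eqmodp subrXX exprSr invfM mulrACA rpredM //.
suff : eqm 1 (\sum_(i < p) x ^+ (p.-1 - i) * y ^+ i) 0.
  by rewrite /eqmodp subr0 expr1.
have xy1 := eqmodp_weaken k0 xy.
apply: (@eqmodp_trans _ _ _ (\sum_(i < p) y ^+ p.-1)).
  apply: eqmodp_sum => i _; have le_ip : (i <= p.-1)%N by have := ltn_ord i; lia.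
  rewrite -[in X in eqmodp _ _ _ X](subnK le_ip) exprD.
  by apply: eqmodpMr; [rewrite rpredX | apply: eqmodpX].
rewrite sumr_const card_ord; apply/eqmodpP; exists (y ^+ p.-1); first by rewrite rpredX.
by rewrite add0r expr1 mulr_natl.
Qed.

Lemma unit_fact_p : unit_fact p = (p.-1)`!%:R.
Proof.
rewrite /unit_fact -[in index_iota _ _](prednK (prime_gt0 p_pr)).
rewrite (@big_ltn_cond _ _ _ 0) // dvdn0 /= fact_prod natr_prod.
rewrite big_nat_cond [RHS]big_nat_cond; apply: eq_bigl => c.
by case: ltnP => //= c0; case: ltnP => //= cp; apply/negP => /dvdn_leq; lia.
Qed.

Lemma prime_gt2_odd : odd p.
Proof. by case: (even_prime p_pr) p_gt2 => [->|]. Qed.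

(** Wilson's theorem for prime powers. The product up to [p^(k+1)] consists of [p] blocks, each
    congruent to the product up to [p^k], and the p-th power raises the precision by one. *)
Lemma unit_fact_wilson k : (0 < k)%N -> eqm k (unit_fact (p ^ k)) (-1).
Proof.
case: k => // k _; elim: k => [|k IH].
  rewrite expn1 unit_fact_p.
  have /dvdnP[c cE] : (p %| (p.-1)`!.+1)%N by rewrite -Wilson // prime_gt1.
  apply/eqmodpP; exists c%:R; first exact: rpred_nat.
  by rewrite expr1 -natrM mulnC -cE -addn1 natrD; ring.
rewrite expnS unit_fact_blocks; last by rewrite dvdn_exp.
have -> : -1 = (-1) ^+ p :> rat.
  by rewrite -signr_odd prime_gt2_odd.
apply: eqmodp_trans (eqmodp_frobenius _ _ IH); rewrite ?rpredN ?rpred1 //.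
rewrite -[X in _ ^+ X]card_ord -prodr_const.
apply: eqmodp_prod => i _; first exact/p_unit_integral/unit_fact_unit.
by apply: eqmodp_weaken (unit_block_mod _ _) => //; lia.
Qed.

(** Each advance by [p^k] multiplies the product by -1 modulo [p^k], and the sign [(-1)^(p^k) = -1]
    compensates. *)
Lemma signed_unit_fact_continuous k n t : (0 < k)%N ->
  eqm k ((-1) ^+ (n + t * p ^ k) * unit_fact (n + t * p ^ k))
        ((-1) ^+ n * unit_fact n).
Proof.
move=> k0; have sgZ j : (-1) ^+ j \in Zloc by rewrite rpredX // rpredN rpred1.
elim: t => [|t IH]; first by rewrite addn0 eqmodp_refl.
apply: eqmodp_trans IH; rewrite mulSn addnCA; move: (n + t * _)%N => {}n.
have -> : (-1) ^+ n * unit_fact n = (-1) ^+ (p ^ k + n) * (-1 * unit_fact n).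
  by rewrite exprD -[(-1) ^+ (p ^ k)]signr_odd oddX prime_gt2_odd orbT; ring.
apply: eqmodpMl => //; rewrite unit_factD ?dvdn_exp //.
apply: eqmodpM; rewrite ?unit_fact_wilson ?rpredN ?rpred1 //.
  by rewrite unit_block_integral // rpred_nat.
apply: eqmodp_prod => c _; first exact: rpred_nat.
apply/eqmodpP; exists 1; rewrite ?rpred1 //; by rewrite mulr1 natrX.
Qed.

End UnitFactorial.

(** * The remaining quotient and the unit factorial at 1/4 *)

Section QuarterPoint.
Variables (p m : nat) (p_pr : prime p) (p_def : p = (4 * m + 3)%N).
Local Notation Zloc := (p_integral p_pr).
Local Notation unit_p := (p_unit p_pr).
Local Notation eqm := (eqmodp p_pr).
Local Notation A := ((p.-1)`!%:R : rat).

Let p_gt2 : (2 < p)%N. Proof. lia. Qed.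

(** Wilson modulo [p], raised to the p-th power for precision [p^2], then cubed. *)
Lemma fact_pred_p_pow : eqm 2 (A ^+ (3 * p)) (-1).
Proof.
have A1 : eqm 1 A (-1).
  by have := unit_fact_wilson p_pr p_gt2 (ltnSn 0); rewrite expn1 unit_fact_p.
have -> : -1 = ((-1) ^+ p) ^+ 3 :> rat.
  by rewrite -signr_odd (prime_gt2_odd p_pr p_gt2); ring.
rewrite mulnC exprM; apply: eqmodpX; first by rewrite rpredX // rpredN rpred1.
by apply: (eqmodp_frobenius p_gt2) A1; rewrite // rpredN rpred1.
Qed.

(* The argument [p(3m+2) + m+1 = (3p^2+1)/4] is [1/4] modulo [p^2]; the fourth
   power works because [4(3m+2) = 3p - 1]. *)
Lemma unit_fact_quarter :
  eqm 2 (unit_fact p (p * (3 * m + 2) + m.+1) ^+ 4 * A)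
    (- (m`!%:R ^+ 3 * \prod_(1 <= l < m.+1) (l%:R - p%:R))).
Proof.
set t := (3 * m + 2)%N; set P := \prod_(1 <= l < m.+1) _.
have blockE z : unit_block p m.+1 z = \prod_(1 <= l < m.+1) (l%:R + z).
  rewrite /unit_block (@big_ltn_cond _ _ _ 0) // dvdn0 /=.
  rewrite big_nat_cond [RHS]big_nat_cond; apply: eq_bigl => l.
  by case: ltnP => //= l0; case: ltnP => //= lm; apply/negP => /dvdn_leq; lia.
have fZ (l : nat) : true -> l%:R \in Zloc by rewrite rpred_nat.
(* The same [b] serves the shift [p t] of the final partial block and the shift [-p] in [P]. *)
have [b bZ bE] := prod_shift_expansion (index_iota 1 m.+1) fZ.
have mfact : m`!%:R = \prod_(1 <= l < m.+1) l%:R :> rat by rewrite fact_prod natr_prod.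
rewrite unit_factD ?dvdn_mulr // blockE.
have [|c cZ cE] := bE (p * t)%:R; first by rewrite rpred_nat.
have [|d dZ dE] := bE (- p%:R); first by rewrite rpredN rpred_nat.
have PE : eqm 2 P (m`!%:R - p%:R * b).
  by rewrite /P dE -mfact mulNr sqrrN; apply: eqmodp_addMr.
have BE : eqm 2 (\prod_(1 <= l < m.+1) (l%:R + (p * t)%:R)) (m`!%:R + (p * t)%:R * b).
  rewrite cE -mfact natrM exprMn -[_ * _ * c]mulrA; apply: eqmodp_addMr => //.
  by rewrite rpredM ?rpredX ?rpred_nat.
have UE : eqm 2 (unit_fact p (p * t)) (A ^+ t).
  rewrite mulnC unit_fact_blocks // -[t in A ^+ t]card_ord -prodr_const.
  apply: eqmodp_prod => i _; first exact: rpred_nat.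
  rewrite -unit_fact_p //.
  by have := unit_block_mod p_pr p_gt2 i (ltnSn 0); rewrite expn1.
have AZ j : A ^+ j \in Zloc by rewrite rpredX // rpred_nat.
have mZ : m`!%:R \in Zloc by rewrite rpred_nat.
have ptbZ : (p * t)%:R * b \in Zloc by rewrite rpredM // rpred_nat.
set Q := \prod_(1 <= l < m.+1) _ in BE *.
apply: (@eqmodp_trans _ _ _ (A ^+ (3 * p) * (m`!%:R + (p * t)%:R * b) ^+ 4)).
  have -> : A ^+ (3 * p) * (m`!%:R + (p * t)%:R * b) ^+ 4 =
      (A ^+ t * (m`!%:R + (p * t)%:R * b)) ^+ 4 * A.
    have -> : (3 * p = t * 4 + 1)%N by rewrite /t; lia.
    by rewrite exprD exprM; ring.
  apply: eqmodpMr; first exact: rpred_nat.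
  apply: eqmodpX; first by rewrite rpredM // rpredD.
  by apply: eqmodpM => //; apply: eqmodp_integral BE _; rewrite rpredD.
apply: (@eqmodp_trans _ _ _ (-1 * (m`!%:R ^+ 3 * (m`!%:R - p%:R * b)))); last first.
  rewrite mulN1r; apply: eqmodpN; apply: eqmodpMl; first by rewrite rpredX.
  exact: eqmodp_sym.
apply: eqmodpM fact_pred_p_pow _; rewrite ?rpredX ?rpredD ?rpredN ?rpred1 //.
(* Hence [4 p t] is [-p] modulo [p^2], which matches the linear term of the fourth power with that
   of [P]. *)
have tE : t%:R = (3 * p%:R - 1) / 4 :> rat.
  have -> : 3 * p%:R - 1 = 4 * t%:R :> rat by rewrite p_def /t; ring.
  by field.
pose e := t%:R * b.
have eZ : e \in Zloc by rewrite rpredM // rpred_nat.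
have -> : (m`!%:R + (p * t)%:R * b) ^+ 4 = m`!%:R ^+ 3 * (m`!%:R - p%:R * b)
   + p%:R ^+ 2 * (3 * b * m`!%:R ^+ 3 + 6 * m`!%:R ^+ 2 * e ^+ 2
      + p%:R * (4 * m`!%:R * e ^+ 3 + p%:R * e ^+ 4)).
  by rewrite /e natrM tE; field.
apply: eqmodp_addMr => //.
have nZ (j : nat) : j%:R \in Zloc by rewrite rpred_nat.
by apply: rpredD; [apply: rpredD | apply: rpredM => //; apply: rpredD];
  rewrite ?rpredM ?rpredX.
Qed.

(** The top [m] factors of [(p-1)!] are the [p - l] for [l] from 1 to [m]. *)
Lemma fact_pred_p : A = (3 * m + 2)`!%:R
  * ((-1) ^+ m * \prod_(1 <= l < m.+1) (l%:R - p%:R)).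
Proof.
have -> : p.-1 = (3 * m + 2 + m)%N by lia.
have gen r : (r <= m)%N -> (3 * m + 2 + m)`!%:R = (4 * m + 2 - r)`!%:R
    * ((-1) ^+ r * \prod_(1 <= l < r.+1) (l%:R - p%:R)) :> rat.
  elim: r => [|r IH] lt_rm.
    by rewrite big_geq // !mulr1; congr (_ `!%:R); lia.
  rewrite big_nat_recr //= IH; last exact: ltnW.
  have -> : (4 * m + 2 - r = (4 * m + 2 - r.+1).+1)%N by lia.
  have -> : p%:R = (4 * m + 2 - r.+1).+1%:R + r.+1%:R :> rat.
    by rewrite -natrD; congr _%:R; lia.
  by rewrite factS natrM exprS; ring.
by rewrite (gen m) //; congr (_ `!%:R * _); lia.
Qed.

(** After a shift by a multiple of [p^2], the linear factors run from [2m+1] down to [m+1] and from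
    [2m+2] up to [3m+2]; with [m!] they fill out [(3m+2)!]. *)
Lemma odd_square_product :
  eqm 2 (m`!%:R * \prod_(j < m.+1) (4 * j + 2)%:R ^+ 2)
        ((-16) ^+ m.+1 * (3 * m + 2)`!%:R).
Proof.
(* Shifted by [(2p)^2], the squares factor as
   [(4j+2)^2 - (2p)^2 = -16 (2m+1-j) (2m+2+j)]. *)
have gen r : (r <= m.+1)%N -> (2 * m + 1 - r)`!%:R *
   \prod_(j < r) ((4 * j + 2)%:R ^+ 2 - (2 * p%:R) ^+ 2) =
   (-16) ^+ r * (2 * m + 1 + r)`!%:R :> rat.
  elim: r => [|r IH] lt_rm; first by rewrite big_ord0 subn0 addn0 mulr1 mul1r.
  rewrite big_ord_recr [(-16) ^+ r.+1]exprS /=.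
  have e1 : (2 * m + 1 - r)`!%:R = (2 * m + 1 - r)%:R * (2 * m + 1 - r.+1)`!%:R :> rat.
    have -> : (2 * m + 1 - r = (2 * m + 1 - r.+1).+1)%N by lia.
    by rewrite factS natrM.
  have nz : (2 * m + 1 - r)%:R != 0 :> rat by rewrite pnatr_eq0; lia.
  apply: (mulfI nz); rewrite !mulrA -e1 IH; last exact: ltnW.
  have -> : (2 * m + 1 + r.+1)`!%:R = (2 * m + 2 + r)%:R * (2 * m + 1 + r)`!%:R :> rat.
    by rewrite -natrM; congr _%:R; rewrite addnS [LHS]factS; congr (_ * _)%N; lia.
  have -> : (2 * m + 1 - r)%:R = 2 * m%:R + 1 - r%:R :> rat.
    by rewrite natrB; [ring | lia].
  have -> : p%:R = 4 * m%:R + 3 :> rat by rewrite p_def; ring.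
  by ring.
have := gen m.+1 (leqnn _); have -> : (2 * m + 1 - m.+1 = m)%N by lia.
have -> : (2 * m + 1 + m.+1 = 3 * m + 2)%N by lia.
move=> <-; apply: eqmodpMl; first exact: rpred_nat.
have shift_eq (a : nat) : eqm 2 (a%:R ^+ 2 - (2 * p%:R) ^+ 2) (a%:R ^+ 2).
  apply/eqmodpP; exists (- 4); first by rewrite rpredN rpred_nat.
  by ring.
apply: eqmodp_sym; apply: eqmodp_prod => j _ //.
by rewrite rpredX // rpred_nat.
Qed.

(** Multiplying by the unit [16 O (p-1)! m!] clears denominators; what remains is the product of
    [unit_fact_quarter] and [odd_square_product]. *)
Lemma product_ratio_unit_fact :
  eqm 2 ((\prod_(j < m) (4 * j + 4)%:R ^+ 2) / \prod_(j < m.+1) (4 * j + 2)%:R ^+ 2)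
        (unit_fact p (p * (3 * m + 2) + m.+1) ^+ 4 / 16).
Proof.
set U := unit_fact _ _; set O := \prod_(j < m.+1) _; set P := \prod_(j < m) _.
have twoU : 2%:R \in unit_p by apply: p_unit_small; lia.
have u16 : 16 \in unit_p by have := p_unitX 4 twoU; rewrite -natrX.
have factU a : (a < p)%N -> a`!%:R \in unit_p.
  elim: a => [|a IH] ap; first exact: p_unit1.
  by rewrite factS natrM; apply: p_unitM; [apply: p_unit_small; lia | apply: IH; lia].
have OU : O \in unit_p.
  apply: p_unit_prod => j _; have -> : (4 * j + 2 = 2 * (2 * j + 1))%N by lia.
  by rewrite p_unitX // natrM p_unitM // p_unit_small //; have := ltn_ord j; lia.
have PE : P = 16 ^+ m * m`!%:R ^+ 2.
  rewrite /P; elim: {+}m => [|r IH]; first by rewrite big_ord0 expr1n mulr1.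
  by rewrite big_ord_recr /= IH factS [(r.+1 * _)%:R]natrM [16 ^+ r.+1]exprS; ring.
have AU : A \in unit_p by apply: factU; lia.
have mU : m`!%:R \in unit_p by apply: factU; lia.
have allU := p_unitM (p_unitM u16 OU) (p_unitM AU mU).
apply: (eqmodp_cancel allU).
have O0 := p_unit_neq0 OU.
have -> : 16 * O * (A * m`!%:R) * (P / O) = 16 ^+ m.+1 * m`!%:R ^+ 3 * A.
  by rewrite PE [16 ^+ m.+1]exprS; field.
have -> : 16 * O * (A * m`!%:R) * (U ^+ 4 / 16) = U ^+ 4 * A * (m`!%:R * O) by field.
apply: eqmodp_sym.
pose B := \prod_(1 <= l < m.+1) (l%:R - p%:R) : rat.
have -> : 16 ^+ m.+1 * m`!%:R ^+ 3 * A =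
   - (m`!%:R ^+ 3 * B) * ((-16) ^+ m.+1 * (3 * m + 2)`!%:R).
  rewrite fact_pred_p -/B [(-16) ^+ m.+1]exprNn [(-1) ^+ m.+1]exprS.
  have sg2 : (-1) ^+ m * (-1) ^+ m = 1 :> rat by rewrite -expr2 sqrr_sign.
  by rewrite -[LHS]mul1r -sg2; ring.
have nZ j : j%:R \in Zloc by rewrite rpred_nat.
have BZ : B \in Zloc by apply: rpred_prod => l _; rewrite rpredB.
have yZ : m`!%:R * O \in Zloc by rewrite rpredM // p_unit_integral.
have xZ : - (m`!%:R ^+ 3 * B) \in Zloc by rewrite rpredN rpredM // rpredX.
exact: (eqmodpM yZ xZ unit_fact_quarter odd_square_product).
Qed.

End QuarterPoint.


(** * p-adic integers and the p-adic Gamma function *)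

Section PadicIntegers.
Local Open Scope classical_set_scope.
Variables (p : nat) (p_pr : prime p).
Local Notation Zp := (padic_int p_pr).
Local Notation Zloc := (p_integral p_pr).

Lemma residue_nat (n k : nat) : (n%:R : Zp) k = (n %% p ^ k)%N.
Proof.
elim: n => [|n IH] //.
by rewrite -addn1 natrD /= IH modnDm.
Qed.

Lemma residue_addMp (y c : Zp) k : (y + (p ^ k)%:R * c) k = y k.
Proof. by rewrite /= residue_nat modnn mul0n mod0n addn0 residue_mod. Qed.

Lemma residue_eq_diff (x y : Zp) k :
  x k = y k -> exists c : Zp, x = y + (p ^ k)%:R * c.
Proof.
move=> xy; set z := x - y.
have zk : z k = 0%N.
  by rewrite /= modnDmr xy subnKC ?residue_le // modnn.
(* Division of [z] by [p^k]: the base-p digits are shifted by [k] places. *)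
have f_compat j : (z (k + j.+1) %/ p ^ k = z (k + j) %/ p ^ k %[mod p ^ j])%N.
  by rewrite [z (k + j)%N]residueP addnS expnD mulnC -modn_divl modn_mod.
exists (padic_mk p_pr f_compat); rewrite -[LHS](subrK y) addrC -/z; congr (_ + _).
apply: padic_ext => j /=; rewrite residue_nat modnMm.
have /divnK : (p ^ k %| z (k + j))%N by rewrite /dvdn residue_mod_le ?leq_addr ?zk.
by rewrite mulnC => ->; rewrite residue_mod_le // leq_addl.
Qed.

(** Euler's theorem gives an inverse modulo each [p^k]; uniqueness of inverses makes them
    compatible. *)
Lemma padic_nat_unit (b : nat) : coprime p b -> (b%:R : Zp) \is a GRing.unit.
Proof.
move=> pb.
have inv_mod k : (b * b ^ (totient (p ^ k)).-1 = 1 %[mod p ^ k])%N.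
  rewrite -expnS prednK ?totient_gt0 ?expn_gt0 ?prime_gt0 //.
  by apply: Euler_exp_totient; rewrite coprime_sym coprimeXl.
have f_compat k : (b ^ (totient (p ^ k.+1)).-1 = b ^ (totient (p ^ k)).-1 %[mod p ^ k])%N.
  set u := (b ^ _)%N; set v := (b ^ _)%N.
  have bu : (b * u = 1 %[mod p ^ k])%N.
    by rewrite -(@modn_dvdm (p ^ k.+1)) ?dvdn_exp2l // inv_mod modn_dvdm ?dvdn_exp2l.
  have bv : (b * v = 1 %[mod p ^ k])%N by apply: inv_mod.
  by rewrite -[u]muln1 -modnMmr -bv modnMmr mulnCA mulnA -modnMml bu modnMml mul1n.
apply/unitrPr; exists (padic_mk p_pr f_compat); apply: padic_ext => k /=.
rewrite residue_nat modnMm.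
exact: inv_mod.
Qed.

Lemma padic_nat_neq0 (n : nat) : (0 < n)%N -> (n%:R : Zp) != 0.
Proof.
move=> n0; apply/eqP => /(congr1 (fun x : Zp => x n)); rewrite residue_nat /= mod0n.
by rewrite modn_small; [lia | apply: ltn_expl; exact: prime_gt1].
Qed.

Lemma padic_frac_nat_neq0 (n : nat) : (0 < n)%N -> (n%:R : padic p_pr) != 0.
Proof.
by move=> n0; rewrite -[n%:R](rmorph_nat (@tofrac _)) tofrac_eq0 padic_nat_neq0.
Qed.

Lemma padic_frac_int_neq0 (z : int) : z != 0 -> (z%:~R : padic p_pr) != 0.
Proof.
case: z => n; first by move=> n0; rewrite padic_frac_nat_neq0 // lt0n.
by move=> _; rewrite NegzE rmorphN oppr_eq0 padic_frac_nat_neq0.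
Qed.

(** [ratr] uses the reduced fraction. In characteristic zero any other fraction gives the same
    value, whence additivity and multiplicativity. *)
Lemma ratr_padic_frac (a b : int) : b != 0 ->
  ratr (a%:~R / b%:~R) = a%:~R / b%:~R :> padic p_pr.
Proof.
move=> b0; set x := _ / _ : rat.
have b0' : b%:~R != 0 :> rat by rewrite intr_eq0.
have d0 := padic_frac_int_neq0 (denq_neq0 x).
apply/eqP; rewrite /ratr eqr_div ?padic_frac_int_neq0 // -!intrM.
apply/eqP; congr (_%:~R).
have xb : x * b%:~R = a%:~R by rewrite /x divfK.
by apply/eqP; rewrite -(eqr_int rat) !intrM numqE mulrAC xb.
Qed.

Lemma ratr_padicD (x y : rat) : ratr (x + y) = ratr x + ratr y :> padic p_pr.
Proof.
rewrite -[x]divq_num_den -[y]divq_num_den !ratr_padic_frac ?denq_neq0 //.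
move: (numq x) (denq x) (denq_neq0 x) (numq y) (denq y) (denq_neq0 y) => a b b0 c d d0.
have b1 : b%:~R != 0 :> rat by rewrite intr_eq0.
have d1 : d%:~R != 0 :> rat by rewrite intr_eq0.
have b2 := padic_frac_int_neq0 b0; have d2 := padic_frac_int_neq0 d0.
have -> : a%:~R / b%:~R + c%:~R / d%:~R = (a * d + c * b)%:~R / (b * d)%:~R :> rat.
  by rewrite addf_div // !intrD !intrM.
by rewrite ratr_padic_frac ?mulf_neq0 // addf_div // !intrD !intrM.
Qed.

Lemma ratr_padicM (x y : rat) : ratr (x * y) = ratr x * ratr y :> padic p_pr.
Proof.
rewrite -[x]divq_num_den -[y]divq_num_den !ratr_padic_frac ?denq_neq0 //.
move: (numq x) (denq x) (denq_neq0 x) (numq y) (denq y) (denq_neq0 y) => a b b0 c d d0.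
by rewrite !mulf_div -!intrM ratr_padic_frac ?mulf_neq0.
Qed.

Lemma tofrac_unitV (x : Zp) : x \is a GRing.unit ->
  tofrac x^-1 = (tofrac x)^-1 :> padic p_pr.
Proof. exact: rmorphV. Qed.

Lemma ratr_p_integral (x : rat) : x \in Zloc ->
  exists c : Zp, ratr x = tofrac c :> padic p_pr.
Proof.
case/p_integralP=> a [b [pb ->]].
have b0 : b != 0 by rewrite -absz_eq0 (coprime_neq0 p_pr pb).
have bU : (b%:~R : Zp) \is a GRing.unit.
  case: b pb {b0} => b pb; first exact: padic_nat_unit.
  by rewrite NegzE rmorphN unitrN; exact: padic_nat_unit.
exists (a%:~R / b%:~R).
by rewrite ratr_padic_frac // tofracM tofrac_unitV // !rmorph_int.
Qed.

Hypothesis p_gt2 : (2 < p)%N.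

(** The integer product here is shared with [unit_fact_int]; through it, congruences of rationals
    pass to p-adic residues. *)
Lemma gammap_nat_int n : gammap_nat p_pr n =
  ((-1) ^+ n * \prod_(1 <= c < n | ~~ (p %| c)%N) c%:Z)%:~R.
Proof.
rewrite rmorphM rmorphXn rmorphN1 rmorph_prod /gammap_nat.
by congr (_ * _); apply: eq_bigr => c _; rewrite -pmulrn.
Qed.

Lemma unit_fact_int n :
  unit_fact p n = (\prod_(1 <= c < n | ~~ (p %| c)%N) c%:Z)%:~R.
Proof.
rewrite rmorph_prod /unit_fact; case: n => [|n]; first by rewrite !big_geq.
by rewrite (@big_ltn_cond _ _ _ 0) // dvdn0.
Qed.

Lemma gammap_nat_continuous k m n : (0 < k)%N -> (m = n %[mod p ^ k])%N ->
  gammap_nat p_pr m k = gammap_nat p_pr n k.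
Proof.
move=> k0; wlog le_nm : m n / (n <= m)%N => [IH|mn].
  by case/orP: (leq_total n m) => le mn; [|symmetry]; apply: IH.
have /dvdnP[t tE] : (p ^ k %| m - n)%N by rewrite -eqn_mod_dvd // mn.
have -> : (m = n + t * p ^ k)%N by rewrite -tE subnKC.
have := signed_unit_fact_continuous p_pr p_gt2 n t k0.
have sgE j (a : int) : (-1) ^+ j * a%:~R = ((-1) ^+ j * a)%:~R :> rat.
  by rewrite rmorphM rmorphXn rmorphN1.
rewrite !unit_fact_int !sgE => /eqmodp_int /dvdzP[d dE].
rewrite !gammap_nat_int (canRL (subrK _) dE).
move: ((-1) ^+ n * _) => s.
have -> : (d * p%:Z ^+ k + s)%:~R = s%:~R + (p ^ k)%:R * d%:~R :> Zp.
  by rewrite intrD [(d * _)%:~R]intrM rmorphXn /= -pmulrn natrX addrC [_%:~R * _]mulrC.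
exact: residue_addMp.
Qed.

(** The limit is built level by level: its residue at [k] is that of [gammap_nat] at a positive
    integer representing [x] modulo [p^k]. *)
Lemma gammap_cvg (x : Zp) :
  cvg (gammap_nat p_pr n @[n --> posnat_to x])%classic.
Proof.
pose a k := (x k + p ^ k)%N.
have a_mod k : (a k %% p ^ k)%N = x k by rewrite modnDr residue_mod.
have f_compat k :
    (gammap_nat p_pr (a k.+1) k.+1 = gammap_nat p_pr (a k) k %[mod p ^ k])%N.
  case: k => [|k]; first by rewrite !modn1.
  rewrite residue_mod_le // residue_mod; apply: gammap_nat_continuous => //.
  by rewrite a_mod -(@modn_dvdm (p ^ k.+2)) ?dvdn_exp2l // a_mod -residueP.
apply: (@cvgP _ _ (padic_mk p_pr f_compat)) => A [k kA].
(* Continuity is available at positive levels, so one level above [k] is taken and then reduced. *)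
exists [set y : Zp | y k.+1 = x k.+1]; first by exists k.+1.
move=> n /= [_]; rewrite residue_nat => nx; apply: kA.
rewrite [LHS]residueP [RHS]residueP; congr (_ %% _)%N.
rewrite -[LHS]residue_mod; congr (_ %% _)%N.
by apply: gammap_nat_continuous => //; rewrite a_mod.
Qed.

Lemma residue_gammap (x : Zp) k n : (0 < k)%N -> (n%:R : Zp) k = x k ->
  gammap x k = gammap_nat p_pr n k.
Proof.
move=> k0; rewrite residue_nat => nx.
have near_lim : nbhs (gammap x) [set y : Zp | y k = gammap x k] by exists k.
have [U [j jU] Uk] := gammap_cvg near_lim.
(* Close enough to [x] for both conditions; adding [p^i] ensures positivity, as the filter
   demands. *)
pose i := maxn j k; pose n' := (x i + p ^ i)%N.
have n'x l : (l <= i)%N -> (n' %% p ^ l)%N = x l.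
  move=> li; rewrite -(@modn_dvdm (p ^ i)) ?dvdn_exp2l //.
  by rewrite modnDr residue_mod residue_mod_le.
have /= <- : gammap_nat p_pr n' k = gammap x k.
  apply: Uk; split; first by rewrite addn_gt0 expn_gt0 (prime_gt0 p_pr) orbT.
  by apply: jU; rewrite residue_nat n'x // leq_maxl.
by apply: gammap_nat_continuous => //; rewrite n'x ?leq_maxr // nx.
Qed.

End PadicIntegers.


(** * The supercongruence *)

(** [4N = 1 + 3p^2] puts [N] at 1/4 modulo [p^2], and the fourth power removes the sign [(-1)^N]. *)
Lemma gammap_quarter (p m : nat) (p_pr : prime p) : p = (4 * m + 3)%N ->
  let U := \prod_(1 <= c < p * (3 * m + 2) + m.+1 | ~~ (p %| c)%N) c%:Z in
  exists c : padic_int p_pr,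
    gammap (1 / 4%:R : padic_int p_pr) ^+ 4 = U%:~R ^+ 4 + (p ^ 2)%:R * c.
Proof.
move=> p_def U; set N := (p * (3 * m + 2) + m.+1)%N.
have p_gt2 : (2 < p)%N by lia.
have u4 : (4%:R : padic_int p_pr) \is a GRing.unit.
  by apply: padic_nat_unit; apply: (@coprimeXr 2 p 2);
    rewrite coprimen2 (prime_gt2_odd p_pr).
have N4 : (4 * N = 1 + p ^ 2 * 3)%N by rewrite /N; nia.
have N_quarter : N%:R = 1 / 4%:R + (p ^ 2)%:R * (3%:R / 4%:R) :> padic_int p_pr.
  have := mulrV u4; set v := 4%:R^-1 => v4; apply: (mulrI u4).
  transitivity ((1 + (p ^ 2)%:R * 3%:R) * (4%:R * v)); last by ring.
  by rewrite v4 mulr1 -[LHS]natrM N4 [LHS]natrD [(p ^ 2 * 3)%:R]natrM.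
have : gammap (1 / 4%:R : padic_int p_pr) 2 = gammap_nat p_pr N 2.
  by apply: residue_gammap => //; rewrite N_quarter residue_addMp.
case/residue_eq_diff => c ->; rewrite gammap_nat_int rmorphM rmorphXn rmorphN1 /= -/U.
move: (U%:~R) ((p ^ 2)%:R) => u q.
set s := (-1) ^+ N; have s4 : s ^+ 4 = 1.
  by rewrite -[4%N]/(2 * 2)%N exprM sqrr_sign expr1n.
(* The binomial expansion of [(s u + q c)^4 - (s u)^4], divided by [q]. *)
exists (4 * (s * u) ^+ 3 * c + 6 * (s * u) ^+ 2 * c * (q * c)
   + 4 * (s * u) * c * (q * c) ^+ 2 + c * (q * c) ^+ 3).
have -> : u ^+ 4 = (s * u) ^+ 4 by rewrite exprMn s4 mul1r.
by ring.
Qed.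

(** * Rewriting the hypergeometric summand *)

Lemma pochhammerS (F : fieldType) (x : F) k :
  pochhammer x k.+1 = pochhammer x k * (x + k%:R).
Proof. exact: big_ord_recr. Qed.

Lemma pochhammer1 (F : fieldType) k : pochhammer (1 : F) k = k`!%:R.
Proof.
elim: k => [|k IH]; first exact: big_ord0.
by rewrite pochhammerS IH factS natrM -natr1 mulrC addrC.
Qed.

Lemma pochhammer_half (F : numFieldType) k :
  pochhammer (1 / 2%:R : F) k = odd_even_ratio F k * k`!%:R.
Proof.
elim: k => [|k IH]; first by rewrite /pochhammer /odd_even_ratio !big_ord0 mulr1.
have k0 : (k%:R + 1 : F) != 0 by rewrite natr1 pnatr_eq0.
rewrite pochhammerS IH odd_even_ratioS factS [(k.+1 * _)%:R]natrM.
have -> : (2 * k + 2)%:R = 2 * (k%:R + 1) :> F by ring.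
by field; rewrite k0.
Qed.

Lemma pochhammer_gt0 (F : numFieldType) (x : F) k : 0 < x -> 0 < pochhammer x k.
Proof. by move=> x0; apply: prodr_gt0 => i _; rewrite ltr_pwDl ?ler0n. Qed.

Lemma pochhammer_succ (F : fieldType) (x : F) k :
  x * pochhammer (x + 1) k = (x + k%:R) * pochhammer x k.
Proof.
elim: k => [|k IH]; first by rewrite /pochhammer !big_ord0 addr0.
by rewrite !pochhammerS mulrA IH; ring.
Qed.

(** [(5/4)_k / (1/4)_k = 4k+1], and the five factorials in the denominator pair with the five copies
    of [(1/2)_k]. *)
Lemma pochhammer_term (k : nat) :
  (pochhammer (5%:R / 4%:R) k * pochhammer (1 / 2%:R) k ^+ 5)
    / (pochhammer (1 / 4%:R) k * pochhammer 1 k ^+ 4) * ((-1) ^+ k / k`!%:R)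
  = (-1) ^+ k * (4 * k + 1)%:R * odd_even_ratio rat k ^+ 5.
Proof.
have q0 : pochhammer (1 / 4%:R : rat) k != 0 by rewrite gt_eqF // pochhammer_gt0.
have -> : pochhammer (5%:R / 4%:R) k = (4 * k + 1)%:R * pochhammer (1 / 4%:R : rat) k.
  have -> : (5%:R / 4%:R = 1 / 4%:R + 1 :> rat) by [].
  have /(congr1 ( *%R 4)) := pochhammer_succ (1 / 4%:R : rat) k.
  have -> (z : rat) : 4 * (1 / 4%:R * z) = z by field.
  by move=> ->; field.
have f0 : k`!%:R != 0 :> rat by rewrite pnatr_eq0 -lt0n fact_gt0.
rewrite pochhammer_half pochhammer1; move: (pochhammer _ _) q0 => q q0.
by field; rewrite f0 q0.
Qed.

Theorem theorem1p1 (p : nat) (p_pr : prime p) (p_ge5 : (5 <= p)%N)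
    (p_mod4 : (p = 3 %[mod 4])%N) :
  let G : padic_int p_pr := gammap (1 / 4%:R) in
  let rhs : padic p_pr := - (p%:R ^+ 3 / 16%:R) * tofrac G ^+ 4 in
  let lhs : rat :=
    \sum_(0 <= k < ((p - 1) %/ 2).+1)
      (pochhammer (5%:R / 4%:R) k * pochhammer (1 / 2%:R) k ^+ 5)
        / (pochhammer (1 / 4%:R) k * pochhammer 1 k ^+ 4)
        * ((-1) ^+ k / (k`!)%:R) in
  let F65 : rat :=
    hypergeom_trunc
      [:: 5%:R / 4%:R; 1 / 2%:R; 1 / 2%:R; 1 / 2%:R; 1 / 2%:R; 1 / 2%:R]
      [:: 1 / 4%:R; 1; 1; 1; 1] (-1) ((p - 1) %/ 2) in
  padic_eqmod (p ^ 5) (ratr lhs) rhs /\ padic_eqmod (p ^ 5) (ratr F65) rhs.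
Proof.
move=> G rhs lhs F65.
have F65E : F65 = lhs.
  apply: eq_bigr => k _; rewrite !big_cons !big_nil !mulr1.
  by congr (_ / _ * _); ring.
rewrite F65E; suff : padic_eqmod (p ^ 5) (ratr lhs) rhs by [].
pose m := (p %/ 4)%N.
have p_def : p = (4 * m + 3)%N by rewrite {1}(divn_eq p 4) p_mod4 mulnC.
have halfE : ((p - 1) %/ 2 = 2 * m + 1)%N by rewrite {1}p_def; lia.
set N := (p * (3 * m + 2) + m.+1)%N.
have [d dZ lhsE] : exists2 d, d \in p_integral p_pr &
    lhs = - p%:R ^+ 3 * (unit_fact p N ^+ 4 / 16) + p%:R ^+ 5 * d.
  apply/eqmodpP; rewrite /lhs halfE big_mkord.
  under eq_bigr => k _ do rewrite pochhammer_term.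
  apply: eqmodp_trans (truncated_sum_product p_pr p_def) _.
  rewrite !mulNr; apply: eqmodpN; apply: (@eqmodp_scale _ _ 3 2).
  exact: product_ratio_unit_fact.
have [c Gc] := gammap_quarter p_pr p_def.
have [e dE] := ratr_p_integral dZ.
have u16 : (16%:R : padic_int p_pr) \is a GRing.unit.
  by apply: padic_nat_unit; apply: (@coprimeXr 4 p 2);
    rewrite coprimen2 (prime_gt2_odd p_pr) //; lia.
have nz16 : 16 != 0 :> padic p_pr by exact: padic_frac_nat_neq0.
(* [e] is the error of the rational congruence; [c / 16] comes from [p^3/16] times the error [p^2 c]
   in the fourth power of [G]. *)
exists (e + c / 16%:R).
rewrite /rhs -/G -tofracXn Gc lhsE unit_fact_int.
move: (\prod_(_ <= _ < _ | _) _) => U.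
have -> : - p%:R ^+ 3 * (U%:~R ^+ 4 / 16) + p%:R ^+ 5 * d =
    (- (p%:Z ^+ 3 * U ^+ 4))%:~R / 16%:~R + (p ^ 5)%:R * d :> rat by field.
rewrite ratr_padicD ratr_padicM ratr_nat dE ratr_padic_frac //.
rewrite tofracD tofracXn rmorph_int !tofracM tofracD tofracM tofrac_unitV //.
rewrite !rmorph_nat.
by field; exact: nz16.
Qed.
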